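(* Let $k_1,k_2,k_3,k_4$ be integers with $k_1>0$, and let $\Gamma$ be the group with generators $e_1,e_2,e_3,\alpha$ and defining relations $$[e_2,e_1]=[e_3,e_1]=1,\qquad [e_3,e_2]=e_1^{k_1},$$ $$\alpha e_1=e_1\alpha,\quad \alpha e_2=e_1^{k_2}e_2^{-1}\alpha,\quad \alpha e_3=e_1^{k_3}e_3^{-1}\alpha,\quad \alpha^2=e_1^{k_4}.$$ Then the Reidemeister spectrum $\mathrm{Spec}_R(\Gamma)$ depends only on $(\bar k_1,\bar k_2,\bar k_3,\bar k_4)\in\{0,1\}^4$, the parities of $(k_1,k_2,k_3,k_4)$, and is given by: (1) $\mathrm{Spec}_R(\Gamma)=2\mathbb{N}\cup\{\infty\}$ if $(\bar k_1,\bar k_2,\bar k_3,\bar k_4)=(0,0,0,1)$; (2) $\mathrm{Spec}_R(\Gamma)=4\mathbb{N}\cup\{\infty\}$ if $(\bar k_1,\bar k_2,\bar k_3,\bar k_4)$ is one of $(0,0,0,0)$, $(0,0,1,0)$, $(0,0,1,1)$, $(0,1,0,0)$, $(0,1,0,1)$, $(0,1,1,0)$, $(0,1,1,1)$; (3) $\mathrm{Spec}_R(\Gamma)=(4\mathbb{N}-2)\cup\{\infty\}$ if $(\bar k_1,\bar k_2,\bar k_3,\bar k_4)$ is one of $(1,0,0,0)$, $(1,0,1,0)$, $(1,1,0,0)$, $(1,1,1,1)$; (4) $\mathrm{Spec}_R(\Gamma)=(2\mathbb{N}+2)\cup\{\infty\}$ if $(\bar k_1,\bar k_2,\bar k_3,\bar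 k_4)$ is one of $(1,0,0,1)$, $(1,0,1,1)$, $(1,1,0,1)$, $(1,1,1,0)$.
   Context: For a group $\Gamma$ and $\varphi\in\mathrm{Aut}(\Gamma)$, define $g\sim_\varphi g'$ iff there is $h\in\Gamma$ with $g=hg'\varphi(h)^{-1}$. The Reidemeister number $R(\varphi)\in\{1,2,3,\dots\}\cup\{\infty\}$ is the number of equivalence classes of $\sim_\varphi$, and $\mathrm{Spec}_R(\Gamma)=\{R(\varphi)\mid\varphi\in\mathrm{Aut}(\Gamma)\}$. Here $\mathbb{N}=\{1,2,3,\dots\}$, and $a\mathbb{N}+b=\{an+b\mid n\in\mathbb{N}\}$. Commutators are $[a,b]=aba^{-1}b^{-1}$. (These groups are the $3$-dimensional non-crystallographic almost-crystallographic groups $\Gamma$ with $\Gamma/\langle e_1\rangle\cong\mathbb{Z}^2\rtimes\{\pm 1\}$-type quotient, in which $\langle e_1,e_2,e_3\rangle$ is the translation subgroup.) *)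

(* Defs.v *)
From HB Require Import structures.
From mathcomp Require Import all_boot all_order all_algebra finmap.
From mathcomp Require Import boolp classical_sets functions cardinality.

Set Implicit Arguments.
Unset Strict Implicit.
Unset Printing Implicit Defensive.

Import Order.TTheory GRing.Theory.

Local Open Scope classical_set_scope.
Local Open Scope quotient_scope.
Local Open Scope group_scope.

(* A letter [(x, b)] stands for the generator [x] if [b = false] and for its  *)
(* formal inverse if [b = true].                                              *)
Definition word (X : choiceType) := seq (X * bool).

Definition word_inv (X : choiceType) (w : word X) : word X :=
  rev [seq (l.1, ~~ l.2) | l <- w].

Definition word_exp (X : choiceType) (x : X) (k : int) : word X :=
  nseq `|k|%N (x, (k < 0)%R).

(* The commutator [u v u^-1 v^-1]; the library commutator is [u^-1 v^-1 u v]. *)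
Definition word_comm (X : choiceType) (u v : word X) : word X :=
  u ++ v ++ word_inv u ++ word_inv v.

Section PresentedGroup.
Variables (X : choiceType) (rels : seq (word X * word X)).

(* The congruence on words generated by free cancellation and the relations   *)
(* [u = v] for [(u, v)] in [rels].                                            *)
Inductive pres_cong : word X -> word X -> Prop :=
| pres_rel u v : (u, v) \in rels -> pres_cong u v
| pres_cancel x b : pres_cong [:: (x, b); (x, ~~ b)] [::]
| pres_cat u u' v v' :
    pres_cong u u' -> pres_cong v v' -> pres_cong (u ++ v) (u' ++ v')
| pres_refl u : pres_cong u u
| pres_sym u v : pres_cong u v -> pres_cong v u
| pres_trans u v w : pres_cong u v -> pres_cong v w -> pres_cong u w.

Definition pres_equiv (u v : word X) : bool := `[< pres_cong u v >].

Lemma pres_equiv_refl : reflexive pres_equiv.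
Proof. by move=> u; apply/asboolP; exact: pres_refl. Qed.

Lemma pres_equiv_sym : symmetric pres_equiv.
Proof. by move=> u v; apply/asboolP/asboolP; exact: pres_sym. Qed.

Lemma pres_equiv_trans : transitive pres_equiv.
Proof.
by move=> v u w /asboolP uv /asboolP vw; apply/asboolP; exact: pres_trans uv vw.
Qed.

Canonical pres_equiv_rel :=
  EquivRel pres_equiv pres_equiv_refl pres_equiv_sym pres_equiv_trans.

Definition presented : Type := {eq_quot pres_equiv_rel}.
HB.instance Definition _ := Choice.on presented.

Definition pres_class (w : word X) : presented := \pi_{eq_quot pres_equiv_rel} w.

Lemma pres_classP u v : pres_class u = pres_class v <-> pres_cong u v.
Proof.
rewrite /pres_class; split=> [/eqmodP /asboolP //|uv].
by apply/eqmodP/asboolP.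
Qed.

Lemma pres_class_surj (g : presented) : exists w, g = pres_class w.
Proof. by exists (repr (g : {eq_quot pres_equiv_rel})); rewrite /pres_class reprK. Qed.

Lemma word_invK : involutive (@word_inv X).
Proof.
move=> w; rewrite /word_inv map_rev revK -map_comp -[RHS]map_id.
by apply: eq_map => -[x b] /=; rewrite negbK.
Qed.

Lemma pres_cong_mulV (w : word X) : pres_cong (w ++ word_inv w) [::].
Proof.
elim: w => [|[x b] w IHw]; first exact: pres_refl.
have -> : ((x, b) :: w) ++ word_inv ((x, b) :: w) =
    [:: (x, b)] ++ (w ++ word_inv w) ++ [:: (x, ~~ b)].
  by rewrite /word_inv /= rev_cons -cats1 catA.
apply: pres_trans (pres_cancel x b).
apply: (@pres_cat [:: (x, b)] [:: (x, b)]); first exact: pres_refl.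
exact: pres_cat IHw (pres_refl _).
Qed.

Lemma pres_cong_inv (u v : word X) :
  pres_cong u v -> pres_cong (word_inv u) (word_inv v).
Proof.
move=> uv; have VM w : pres_cong (word_inv w ++ w) [::].
  by rewrite -[X in _ ++ X]word_invK; exact: pres_cong_mulV.
apply: (@pres_trans _ (word_inv u ++ (v ++ word_inv v))).
  rewrite -[X in pres_cong X _]cats0; apply: pres_cat; first exact: pres_refl.
  by apply: pres_sym; exact: pres_cong_mulV.
rewrite catA -[X in pres_cong _ X]cat0s; apply: pres_cat; last exact: pres_refl.
apply: pres_trans (VM u); apply: pres_cat; first exact: pres_refl.
exact: pres_sym.
Qed.

Let rep (g : presented) : word X := repr (g : {eq_quot pres_equiv_rel}).

Definition pres_one : presented := pres_class [::].
Definition pres_mul (g h : presented) : presented := pres_class (rep g ++ rep h).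
Definition pres_inv (g : presented) : presented := pres_class (word_inv (rep g)).

Let rep_cong w : pres_cong (rep (pres_class w)) w.
Proof. by apply/pres_classP; rewrite {1}/pres_class reprK. Qed.

Lemma pres_class_cat u v :
  pres_class (u ++ v) = pres_mul (pres_class u) (pres_class v).
Proof.
apply/pres_classP; apply: pres_sym.
by apply: pres_cat; exact: rep_cong.
Qed.

Lemma pres_class_inv u : pres_class (word_inv u) = pres_inv (pres_class u).
Proof.
by apply/pres_classP; apply: pres_sym; apply: pres_cong_inv; exact: rep_cong.
Qed.

Let pres_mulA : associative pres_mul.
Proof.
move=> a b c; have [u ->] := pres_class_surj a.
have [v ->] := pres_class_surj b; have [w ->] := pres_class_surj c.
by rewrite -!pres_class_cat catA.
Qed.

Let pres_mul1 : left_id pres_one pres_mul.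
Proof. by move=> a; have [u ->] := pres_class_surj a; rewrite -pres_class_cat. Qed.

Let pres_mulr1 : right_id pres_one pres_mul.
Proof.
by move=> a; have [u ->] := pres_class_surj a; rewrite -pres_class_cat cats0.
Qed.

Let pres_mulrV : right_inverse pres_one pres_inv pres_mul.
Proof.
move=> a; have [u ->] := pres_class_surj a.
by rewrite -pres_class_inv -pres_class_cat; apply/pres_classP; exact: pres_cong_mulV.
Qed.

Let pres_mulVr : left_inverse pres_one pres_inv pres_mul.
Proof.
move=> a; have [u ->] := pres_class_surj a.
rewrite -{2}(word_invK u) -pres_class_inv -pres_class_cat.
by apply/pres_classP; exact: pres_cong_mulV.
Qed.

HB.instance Definition _ := isGroup.Build presented
  pres_mulA pres_mul1 pres_mulr1 pres_mulVr pres_mulrV.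

End PresentedGroup.

Section Reidemeister.
Variable G : groupType.

Definition twisted_conj (phi : G -> G) (g g' : G) : Prop :=
  exists h : G, g = h * g' * (phi h)^-1.

Definition reidemeister_classes (phi : G -> G) : set (set G) :=
  [set [set g' | twisted_conj phi g g'] | g in [set: G]].

(* [None] encodes the value infinity. *)
Definition reidemeister_number (phi : G -> G) : option nat :=
  let C := reidemeister_classes phi in
  if `[< finite_set C >] then Some #|` fset_set C|%fset else None.

Definition spec_R : set (option nat) :=
  [set reidemeister_number phi
    | phi in [set phi : {multiplicative G -> G} | bijective phi]].

End Reidemeister.

Definition with_infty (A : set nat) : set (option nat) := Some @` A `|` [set None].

Definition pos_nat : set nat := [set n | (0 < n)%N].

(* The generators are [e1 = 0], [e2 = 1], [e3 = 2] and [alpha = 3] in ['I_4]. *)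
Definition ac_rels (k1 k2 k3 k4 : int) : seq (word 'I_4 * word 'I_4) :=
  let e1 := word_exp (inord 0 : 'I_4) in
  let e2 := word_exp (inord 1 : 'I_4) in
  let e3 := word_exp (inord 2 : 'I_4) in
  let alpha := word_exp (inord 3 : 'I_4) in
  [:: (word_comm (e2 1) (e1 1), [::]);
      (word_comm (e3 1) (e1 1), [::]);
      (word_comm (e3 1) (e2 1), e1 k1);
      (alpha 1 ++ e1 1, e1 1 ++ alpha 1);
      (alpha 1 ++ e2 1, e1 k2 ++ e2 (-1) ++ alpha 1);
      (alpha 1 ++ e3 1, e1 k3 ++ e3 (-1) ++ alpha 1);
      (alpha 2, e1 k4)]%R.

Definition ac_group (k1 k2 k3 k4 : int) : groupType :=
  presented (ac_rels k1 k2 k3 k4).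

Definition parities (k1 k2 k3 k4 : int) : int * int * int * int :=
  (k1 %% 2, k2 %% 2, k3 %% 2, k4 %% 2)%Z.

(* Main.v *)
Require Import Defs.
From HB Require Import structures.
From mathcomp Require Import all_boot all_order all_algebra finmap.
From mathcomp Require Import boolp classical_sets cardinality.
From mathcomp Require Import zify ring.

(** Write an element of the group as e1^x e2^y e3^z alpha^b.  An automorphism
    phi maps e1 to e1^nu with nu = 1 or nu = -1, preserves the translation
    subgroup N = <e1, e2, e3>, acts on N / <e1> = Z^2 by a matrix L with
    det L = nu, and maps alpha to (r, w) alpha for some w in Z^2
    ([aut_induces], [induces_det]).  For u in Z^2 let q(u) be the exponent of
    the central element (u alpha)^2; since phi preserves squares,
    q(L u + w) = q(u) modulo 2, and conversely every L of determinant -1 and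
    every w with this property come from an automorphism ([aut_exists]).

    The number R(phi) is infinite if nu = 1 or tr L = 0: either 1 - L is
    singular, or infinitely many powers of e1 are pairwise inequivalent
    ([reidemeister_singular], [reidemeister_central]).  Otherwise

      R(phi) = 2 (|tr L| + f),
      f = the number of u in (Z/2)^2 with L u + w = u and q(u) = 0,

    ([reidemeister_finite]).  Indeed, under twisted conjugation by N alone, each
    of the two cosets of N falls into 2 |tr L| classes, a parity times an
    element of Z^2 / (1 - L) or Z^2 / (1 + L), both of order |tr L|.  The
    element alpha acts on these 4 |tr L| classes as an involution, so its number
    of orbits is half the sum of 4 |tr L| and the number of its fixed classes.
    A class [g] is fixed if and only if some h = u alpha satisfies
    h g phi(h)^-1 = g.  If this equation holds up to a factor e1^delta, then
    conjugating phi by g and comparing squares gives delta = q(u), up to an even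
    number that the choice of h can absorb: so [g] is fixed exactly when q(u) is
    even, and u modulo 2 determines g up to N and the parity.  This gives
    4 f fixed classes.

    It remains to decide, for the sixteen parities of (k1, k2, k3, k4), which
    values |tr L| + f takes.  Modulo 2 the affine map u -> L u + w permutes the
    zeros of q.  If k1 is odd, q has one or three zeros; if k1 is even, none,
    two or four.  The parity of |tr L| + f is then read off from the finitely
    many affine maps of (Z/2)^2 ([fixed_count_parity]), and explicit matrices
    realise all the values that this allows ([spectrum_sup]). *)

Set Implicit Arguments.
Unset Strict Implicit.
Unset Printing Implicit Defensive.

Import Order.TTheory GRing.Theory Num.Theory.

Local Open Scope classical_set_scope.
Local Open Scope group_scope.

(** * Reidemeister numbers *)

(** The map [c] identifies the set of [E]-classes with [F]. *)
Definition classifies (X F : Type) (E : X -> X -> Prop) (c : X -> F) :=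
  (forall f, exists x, c x = f) /\ (forall x y, c x = c y <-> E x y).

Lemma mult_one (G H : groupType) (phi : {multiplicative G -> H}) : phi 1 = 1.
Proof. by apply: (@mulgI _ (phi 1)); rewrite -gmulfM !mulg1. Qed.

Lemma mult_inv (G H : groupType) (phi : {multiplicative G -> H}) (g : G) :
  phi g^-1 = (phi g)^-1.
Proof. by apply: (@mulgI _ (phi g)); rewrite -gmulfM !mulgV mult_one. Qed.

(** The form without inverses is the one used for computations. *)
Lemma twisted_conjP (G : groupType) (phi : {multiplicative G -> G}) (g g' : G) :
  twisted_conj phi g g' <-> exists h, g * phi h = h * g'.
Proof.
split=> -[h]; first by move=> ->; exists h; rewrite -mulgA mulVg mulg1.
by move=> e; exists h; rewrite -e -mulgA mulgV mulg1.
Qed.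

(** Twisted conjugation by the elements of [S] only: its classes are easier to
    count than those of the whole group. *)
Definition twisted_by (G : groupType) (S : G -> Prop) (phi : G -> G) (g g' : G) :=
  exists2 h, S h & g * phi h = h * g'.

Lemma twisted_by_equiv (G : groupType) (S : G -> Prop) (phi : {multiplicative G -> G}) :
  S 1 -> (forall g, S g -> S g^-1) -> (forall g h, S g -> S h -> S (g * h)) ->
  [/\ forall g, twisted_by S phi g g,
      forall g g', twisted_by S phi g g' -> twisted_by S phi g' g &
      forall g1 g2 g3, twisted_by S phi g1 g2 -> twisted_by S phi g2 g3 ->
        twisted_by S phi g1 g3].
Proof.
move=> S1 SV SM; split=> [g|g g' [h Sh e]|g1 g2 g3 [h Sh e] [h' Sh' e']].
- by exists 1; rewrite // mult_one mulg1 mul1g.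
- exists h^-1; first exact: SV.
  by rewrite mult_inv -[g'](mulKg h) -e -!mulgA mulgV mulg1.
- by exists (h * h'); [exact: SM|rewrite gmulfM mulgA e -mulgA e' mulgA].
Qed.

Lemma twisted_conj_equiv (G : groupType) (phi : {multiplicative G -> G}) :
  [/\ forall g, twisted_conj phi g g,
      forall g g', twisted_conj phi g g' -> twisted_conj phi g' g &
      forall g1 g2 g3, twisted_conj phi g1 g2 -> twisted_conj phi g2 g3 ->
        twisted_conj phi g1 g3].
Proof.
have [Erefl Esym Etrans] := @twisted_by_equiv G (fun=> True) phi
  I (fun _ _ => I) (fun _ _ _ _ => I).
have E g g' : twisted_conj phi g g' <-> twisted_by (fun=> True) phi g g'.
  by rewrite twisted_conjP; split=> [[h]|[h _]]; exists h.
split=> [g|g g'|g1 g2 g3]; rewrite !E; [exact: Erefl|exact: Esym|exact: Etrans].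
Qed.

Section ReidemeisterNumber.
Variables (G : groupType) (phi : {multiplicative G -> G}).

Let class (g : G) : set G := [set g' | twisted_conj phi g g'].

Let class_eq g g' : class g = class g' <-> twisted_conj phi g g'.
Proof.
have [Erefl Esym Etrans] := twisted_conj_equiv phi.
split=> [e|e]; first by rewrite -[twisted_conj _ _ _]/(class g g') e; exact: Erefl.
by apply/seteqP; split=> x /= h; [apply: Etrans h; apply: Esym|apply: Etrans h].
Qed.

Lemma reidemeister_number_Some n :
  reidemeister_number phi = Some n <->
  exists c : G -> 'I_n, classifies (twisted_conj phi) c.
Proof.
pose C := reidemeister_classes phi.
have CE g : C (class g) by exists g.
suff card_n : (C #= `I_n)%card <->
    exists c : G -> 'I_n, classifies (twisted_conj phi) c.
  rewrite -card_n /reidemeister_number -/C; case: asboolP => [Cfin|Cinf].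
    split=> [[<-]|/card_fset_set->//].
    by rewrite -[in X in (X #= _)%card](fset_setK Cfin); apply/card_eq_fsetP.
  by split=> // Cn; case: Cinf; apply/finite_setP; exists n.
split.
- move=> /card_set_bijP[f [fF fI fS]].
  have fC g : (f (class g) < n)%N by apply: fF.
  exists (fun g => Ordinal (fC g)); split=> [[i i_n]|g g'].
    by have [_ [g _ <-] fg] := fS i i_n; exists g; apply: val_inj.
  rewrite -class_eq; split=> [[]|/= e]; last by apply: val_inj; rewrite /= e.
  by apply: fI; rewrite inE.
- move=> [c [cS cE]].
  pose r i := sval (cid (cS i)).
  have rK i : c (r i) = i := svalP (cid (cS i)).
  rewrite (card_eqr card_II) card_eq_sym; apply/card_set_bijP.
  exists (class \o r); split=> [i _|i j _ _ /class_eq/cE|_ [g _ <-]].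
  + exact: CE.
  + by rewrite !rK.
  + by exists (c g) => //; apply/class_eq/cE; rewrite rK.
Qed.

Lemma reidemeister_number_None (g_ : nat -> G) :
  (forall i j, twisted_conj phi (g_ i) (g_ j) -> i = j) ->
  reidemeister_number phi = None.
Proof.
move=> g_inj; case En: reidemeister_number => [n|//].
have [c [_ cE]] := (reidemeister_number_Some n).1 En.
have /leq_card : injective (fun i : 'I_n.+1 => c (g_ i)).
  by move=> i j /cE /g_inj; apply: val_inj.
by rewrite !card_ord ltnn.
Qed.

End ReidemeisterNumber.

Lemma mult_of (G H : groupType) (f : G -> H) :
  {morph f : x y / x * y} ->
  exists phi : {multiplicative G -> H}, phi = f :> (G -> H).
Proof.
move=> fM.
by exists (HB.pack_for {multiplicative G -> H} f (isMultiplicative.Build G H f fM)).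
Qed.

Lemma spec_R_sub (G H : groupType) (F : {multiplicative G -> H}) :
  bijective F -> spec_R G `<=` spec_R H.
Proof.
move=> [F' FK F'K] _ [phi [phi' phiK phi'K] <-].
have F'M : {morph F' : x y / x * y} by apply: can2_gmulfM FK F'K.
have [psi psiE] : exists psi : {multiplicative H -> H},
    psi = F \o phi \o F' :> (H -> H).
  by apply: mult_of => x y /=; rewrite F'M !gmulfM.
have numE n : reidemeister_number psi = Some n <-> reidemeister_number phi = Some n.
  rewrite !reidemeister_number_Some; split=> -[c [cS cE]].
  - exists (c \o F); split=> [i|x y].
      by have [y <-] := cS i; exists (F' y); rewrite /= F'K.
    rewrite /= cE !twisted_conjP psiE; split=> -[h e].
      exists (F' h); apply: (can_inj FK).
      by rewrite !gmulfM F'K -e.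
    by exists (F h); rewrite /= FK -!gmulfM e.
  - exists (c \o F'); split=> [i|x y].
      by have [y <-] := cS i; exists (F y); rewrite /= FK.
    rewrite /= cE !twisted_conjP psiE; split=> -[h e].
      by exists (F h); rewrite -[x]F'K -[y]F'K /= FK -!gmulfM e.
    by exists (F' h); apply: (can_inj FK); rewrite !gmulfM !F'K e.
exists psi => /=.
  by rewrite psiE; exists (F \o phi' \o F') => x /=; rewrite ?FK ?phiK ?phi'K ?F'K.
case Ephi : (reidemeister_number phi) numE => [n|] numE; first exact/numE.
by case Epsi : (reidemeister_number psi) => [n|//]; move/numE: Epsi.
Qed.

Lemma spec_R_iso (G H : groupType) (F : {multiplicative G -> H}) :
  bijective F -> spec_R G = spec_R H.
Proof.
move=> Fbij; apply/seteqP; split; first exact: spec_R_sub Fbij.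
have [F' FK F'K] := Fbij.
have [F'' F''E] := mult_of (can2_gmulfM FK F'K).
by apply: (spec_R_sub (F := F'')); rewrite F''E; exists F.
Qed.

(** Let the involution [s] act on the [E0]-classes; then [E] is the relation of
    having the same orbit, and the orbits are the orbits with two elements and
    the fixed classes.  Hence twice their number is the number of classes plus
    the number of fixed ones. *)
Lemma involution_orbits (X : Type) (F : finType) (c : X -> F)
    (E0 E : X -> X -> Prop) (s : X -> X) (fixed : pred F) :
  classifies E0 c ->
  (forall x y, E0 x y -> E0 (s x) (s y)) -> (forall x, E0 (s (s x)) x) ->
  (forall x y, E x y <-> E0 x y \/ E0 x (s y)) ->
  (forall x, fixed (c x) <-> E0 x (s x)) ->
  exists n (d : X -> 'I_n), n.*2 = #|F| + #|fixed| /\ classifies E d.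
Proof.
move=> [cS cE] sE ssE EE fixE.
pose r f := sval (cid (cS f)).
have rK f : c (r f) = f := svalP (cid (cS f)).
pose t f := c (s (r f)).
have tc x : t (c x) = c (s x) by apply/cE/sE/cE; rewrite rK.
have tK f : t (t f) = f by rewrite -[f]rK !tc; apply/cE/ssE.
have fixt f : fixed f = (t f == f).
  rewrite -[f]rK tc; apply/idP/eqP; first by move/fixE/cE => ->.
  by move=> e; apply/fixE/cE.
(* Each orbit is represented by its element of smaller rank.  Both [lo] and
   its image under the involution have as many elements as there are orbits;
   their union is everything and their intersection is the set of fixed
   points. *)
pose lo f := (enum_rank f <= enum_rank (t f))%N.
pose rep f := if lo f then f else t f.
have lo_rep f : lo (rep f).
  rewrite /rep; case: ifP => // /negbT; rewrite /lo -ltnNge tK; exact: ltnW.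
have repP f g : rep f = rep g <-> f = g \/ f = t g.
  split.
    rewrite /rep; do 2!case: ifP => _; first by left.
    + by move=> ->; right.
    + by move=> <-; right; rewrite tK.
    + by move/(can_inj tK); left.
  by case=> [->//|->]; rewrite /rep /lo tK; case: ltngtP => // /val_inj/enum_rank_inj.
have lo_card : (#|[pred f | lo f]|.*2 = #|F| + #|fixed|)%N.
  rewrite -addnn -[X in (_ + X)%N](fintype.card_image (can_inj tK)).
  rewrite -cardUI; congr (_ + _)%N.
    apply: eq_card => f; rewrite !inE.
    have -> : (f \in [seq t x | x in [pred f0 | lo f0]]) = lo (t f).
      by rewrite -{1}[f]tK fintype.mem_image//; apply: can_inj tK.
    by rewrite /lo tK leq_total.
  apply: eq_card => f; rewrite !inE.
  have -> : (f \in [seq t x | x in [pred f0 | lo f0]]) = lo (t f).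
    by rewrite -{1}[f]tK fintype.mem_image//; apply: can_inj tK.
  rewrite /lo tK -eqn_leq -[RHS]/(fixed f) fixt.
  by apply/eqP/eqP => [/val_inj/enum_rank_inj|->].
pose L : finType := {f : F | lo f}.
exists #|[pred f | lo f]|.
pose d x : L := Sub (rep (c x)) (lo_rep _).
have cardL : #|L| = #|[pred f | lo f]| by rewrite card_sig.
exists (fun x => cast_ord cardL (enum_rank (d x))); split=> //; split.
  move=> i; pose f := enum_val (cast_ord (esym cardL) i).
  have [x xf] := cS (val f); exists x.
  have -> : d x = f by apply: val_inj; rewrite /= xf /rep (valP f).
  by rewrite enum_valK cast_ordKV.
move=> x y; rewrite EE -!cE -tc -repP.
split=> [/cast_ord_inj/enum_rank_inj/(congr1 val)//|e].
by congr (cast_ord _ (enum_rank _)); apply: val_inj.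
Qed.

(** * Lattices in the plane and parities *)

Lemma zmod_classes (g : int) : g != 0%R ->
  exists r : int -> 'I_`|g|%N,
    classifies (fun x y => exists k : int, x = y + g * k)%R r.
Proof.
move=> g0.
have r_lt x : (`|(x %% g)%Z| < `|g|)%N.
  by have := ltz_mod x g0; have := modz_ge0 x g0; lia.
exists (fun x => Ordinal (r_lt x)); split=> [i|x y].
  exists (i : int)%R; apply: val_inj => /=; have := ltn_ord i => i_lt.
  by rewrite -modz_abs modz_small //; lia.
split=> [[e]|[k ->]]; last by apply: val_inj; rewrite /= addrC [(g * k)%R]mulrC modzMDl.
exists ((x %/ g)%Z - (y %/ g)%Z)%R.
have := divz_eq x g; have := divz_eq y g.
have := modz_ge0 x g0; have := modz_ge0 y g0. nia.
Qed.

(** The lattice spanned by the columns of a matrix of non-zero determinant has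
    index the absolute value of the determinant.  By Bezout on the first row,
    integral column operations make the matrix lower triangular, with diagonal
    [g] and [f]; a point is then classified by its first coordinate modulo [g]
    and, after subtraction of a multiple of the first column, by its second
    coordinate modulo [f]. *)
Lemma plane_index (a b c d : int) : (a * d - b * c != 0)%R ->
  exists (F : finType) (r : int * int -> F),
    #|F| = `|(a * d - b * c)%R|%N /\
    classifies (fun v v' => exists u1 u2 : int,
      v = (v'.1 + (a * u1 + c * u2), v'.2 + (b * u1 + d * u2)))%R r.
Proof.
move=> D0; have [x [y xy]] : exists x y : int, (x * a + y * c = gcdz a c)%R.
  by have [x [y e]] := Bezoutz a c; exists x, y.
set g := gcdz a c in xy.
have [a' a'E] : exists a' : int, (a = a' * g)%R by apply/dvdzP; exact: dvdz_gcdl.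
have [c' c'E] : exists c' : int, (c = c' * g)%R by apply/dvdzP; exact: dvdz_gcdr.
have g0 : g != 0%R.
  by apply: contraNneq D0 => e; rewrite a'E c'E e !mulr0 mul0r subrr.
have xy1 : (x * a' + y * c' = 1)%R.
  by apply: (mulIf g0); rewrite mul1r -[RHS]xy a'E c'E; ring.
pose e := (b * x + d * y)%R; pose f := (d * a' - b * c')%R.
have Dgf : (a * d - b * c = g * f)%R by rewrite a'E c'E /f; ring.
have f0 : f != 0%R by apply: contraNneq D0 => f0; rewrite Dgf f0 mulr0.
have [rg [rgS rgE]] := zmod_classes g0; have [rf [rfS rfE]] := zmod_classes f0.
exists ('I_`|g|%N * 'I_`|f|%N)%type.
exists (fun v => (rg v.1, rf (v.2 - e * (v.1 %/ g)%Z)%R)).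
split; first by rewrite card_prod !card_ord Dgf abszM.
split=> [[i j]|[v1 v2] [w1 w2] /=].
  have [v1 <-] := rgS i; have [v2 <-] := rfS j.
  by exists (v1, v2 + e * (v1 %/ g)%Z)%R; rewrite /= addrK.
split=> [[/rgE[k ->] /rfE[l]]|[u1 [u2 [-> ->]]]].
  rewrite [(g * k)%R]mulrC [(w1 + _)%R]addrC divzMDl // => /eqP.
  rewrite subr_eq => /eqP ->.
  exists (k * x - l * c')%R, (k * y + l * a')%R; congr (_, _).
    rewrite [in RHS]a'E [in RHS]c'E -[in LHS](mulr1 (k * g)%R) -xy1; ring.
  by rewrite /e /f; ring.
pose k := (a' * u1 + c' * u2)%R.
have -> : (a * u1 + c * u2 = k * g)%R by rewrite a'E c'E /k; ring.
congr (_, _); first by apply/rgE; exists k; rewrite mulrC.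
apply/rfE; exists (x * u2 - y * u1)%R; rewrite [(w1 + _)%R]addrC divzMDl //.
have -> : (b * u1 + d * u2 = (b * u1 + d * u2) * (x * a' + y * c'))%R.
  by rewrite xy1 mulr1.
rewrite /k /e /f; ring.
Qed.

Lemma linear_inj (a' b' c' d' u v : int) : (a' * d' - b' * c' != 0 ->
  a' * u + c' * v = 0 -> b' * u + d' * v = 0 -> u = 0 /\ v = 0)%R.
Proof.
move=> det eu ev; split; apply: (mulfI det); rewrite mulr0.
  transitivity (d' * (a' * u + c' * v) - c' * (b' * u + d' * v))%R; first by ring.
  by rewrite eu ev; ring.
transitivity (a' * (b' * u + d' * v) - b' * (a' * u + c' * v))%R; first by ring.
by rewrite eu ev; ring.
Qed.

Definition par (x : int) : bool := (x %% 2)%Z == 1%R.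

Lemma parP x : exists k : int, (x = 2 * k + (par x)%:R)%R.
Proof.
exists (x %/ 2)%Z; have := divz_eq x 2; have := modz_ge0 x (isT : (2 != 0 :> int)%R).
have := ltz_mod x (isT : (2 != 0 :> int)%R); rewrite /par; case: eqP => [->|?] /=; lia.
Qed.

Lemma par_unique (x k : int) (b : bool) : (x = 2 * k + b%:R)%R -> par x = b.
Proof.
have [l e] := parP x; case: (par x) e; case: b => //; lia.
Qed.

Lemma parD x y : par (x + y)%R = par x (+) par y.
Proof.
have [k ek] := parP x; have [l el] := parP y.
apply: (@par_unique _ (k + l + (par x && par y)%:R)%R); rewrite {1}ek {1}el.
by case: (par x); case: (par y) => /=; lia.
Qed.

Lemma parN x : par (- x)%R = par x.
Proof.
have [k ek] := parP x.
apply: (@par_unique _ (- k - (par x)%:R)%R); rewrite {1}ek.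
by case: (par x) => /=; lia.
Qed.

Lemma parM x y : par (x * y)%R = par x && par y.
Proof.
have [k ek] := parP x; have [l el] := parP y.
apply: (@par_unique _ (2 * k * l + k * (par y)%:R + l * (par x)%:R)%R).
rewrite {1}ek {1}el; case: (par x); case: (par y) => /=; lia.
Qed.

Definition parE := (parD, parN, parM).

Lemma par_eq x y : par x = par y <-> exists k : int, (x = y + 2 * k)%R.
Proof.
split=> [e|[k ->]]; last by rewrite !parE addbF.
by have [k ->] := parP x; have [l ->] := parP y; exists (k - l)%R; rewrite e; lia.
Qed.

(** * The group in coordinates *)

Section IntegerPowers.
Variable G : groupType.
Implicit Types (g h c : G) (m n : int).

(** The constructor [Negz k] is the integer - (k + 1). *)
Definition zpow g n : G := if n is Negz k then g ^- k.+1 else g ^+ `|n|%N.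

Lemma zpow0 g : zpow g 0%R = 1. Proof. by []. Qed.

Lemma zpow1 g : zpow g 1%R = g. Proof. by []. Qed.

Lemma zpowVn g (n : nat) : zpow g (- n%:Z)%R = g ^- n.
Proof. by case: n => [|n] //=; rewrite ?NegzE // expg0 invg1. Qed.

Lemma zpowN1 g : zpow g (-1)%R = g^-1. Proof. by []. Qed.

Lemma zpowS g n : zpow g (n + 1)%R = zpow g n * g.
Proof.
case: n => n; first by rewrite -PoszD addn1 /= expgSr.
rewrite (_ : (Negz n + 1)%R = - n%:Z)%R; last by rewrite NegzE; lia.
by rewrite zpowVn /= expgS invgM mulgVK.
Qed.

Lemma zpowP g n : zpow g (n - 1)%R = zpow g n * g^-1.
Proof. by rewrite -{2}[n](subrK 1%R) zpowS mulgK. Qed.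

Lemma zpowD g m n : zpow g (m + n)%R = zpow g m * zpow g n.
Proof.
elim: n => [|n IHn|n IHn]; first by rewrite addr0 mulg1.
  by rewrite -addn1 PoszD addrA !zpowS IHn mulgA.
by rewrite -addn1 PoszD opprD addrA !zpowP IHn mulgA.
Qed.

Lemma zpowN g n : zpow g (- n)%R = (zpow g n)^-1.
Proof. by apply: (@mulgI _ (zpow g n)); rewrite -zpowD subrr mulgV. Qed.

Lemma zpow_conj h g g' n : h * g = g' * h -> h * zpow g n = zpow g' n * h.
Proof.
move=> e; elim: n => [|n IHn|n IHn]; first by rewrite mulg1 mul1g.
  by rewrite -addn1 PoszD !zpowS mulgA IHn -mulgA e mulgA.
rewrite -addn1 PoszD opprD !zpowP mulgA IHn -!mulgA; congr (_ * _).
by apply: (@mulgI _ g'); rewrite mulVKg mulgA -e -mulgA mulgV mulg1.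
Qed.

Lemma commute_zpow h g n : commute h g -> commute h (zpow g n).
Proof. exact: zpow_conj. Qed.

Lemma zpowMg g h n : commute g h -> zpow (g * h) n = zpow g n * zpow h n.
Proof.
move=> gh; elim: n => [|n IHn|n IHn]; first by rewrite mulg1.
  have := commute_zpow n gh; rewrite -addn1 PoszD !zpowS IHn => e.
  by rewrite -!mulgA; congr (_ * _); rewrite !mulgA e.
have := commute_zpow (- n%:Z)%R (commute_sym (commuteV (commute_sym gh))).
rewrite -addn1 PoszD opprD !zpowP IHn => e.
by rewrite gh invgM -!mulgA; congr (_ * _); rewrite !mulgA e.
Qed.

Lemma zpowM g m n : zpow g (m * n)%R = zpow (zpow g m) n.
Proof.
elim: n => [|n IHn|n IHn]; first by rewrite mulr0.
  by rewrite -addn1 PoszD zpowS -IHn mulrDr mulr1 zpowD.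
by rewrite -addn1 PoszD opprD zpowP -IHn mulrDr mulrN1 zpowD zpowN.
Qed.

(** Conjugation by [h] sends [g] to [c * g'], hence [g^n] to [c^n * g'^n]. *)
Lemma zpow_skew c h g g' n :
  commute c g' -> h * g = c * g' * h -> h * zpow g n = zpow c n * zpow g' n * h.
Proof. by move=> cg' /(zpow_conj n) ->; rewrite zpowMg. Qed.

End IntegerPowers.

Lemma mult_zpow (G H : groupType) (phi : {multiplicative G -> H}) (g : G) n :
  phi (zpow g n) = zpow (phi g) n.
Proof.
elim: n => [|n IHn|n IHn]; first by rewrite mult_one.
  by rewrite -addn1 PoszD !zpowS gmulfM IHn.
by rewrite -addn1 PoszD opprD !zpowP gmulfM IHn mult_inv.
Qed.

Definition sgb (b : bool) (y : int) : int := (if b then - y else y)%R.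

(** The tuple (x, y, z, b) stands for e1^x e2^y e3^z alpha^b; the parameters
    only determine the multiplication. *)
Definition ac_model (k1 k2 k3 k4 : int) : Type := (int * int * int * bool)%type.

HB.instance Definition _ k1 k2 k3 k4 := Choice.on (ac_model k1 k2 k3 k4).

Section ModelGroup.
Variables k1 k2 k3 k4 : int.
Local Notation M := (ac_model k1 k2 k3 k4).

(** Move alpha^b and then e3^z past e2^y': this contributes the powers of e1
    that the defining relations prescribe, and alpha^2 contributes e1^k4. *)
Definition model_mul (g h : M) : M :=
  let: (x, y, z, b) := g in let: (x', y', z', b') := h in
  ((x + x' + if b then k2 * y' + k3 * z' - k1 * z * y' + (if b' then k4 else 0)
             else k1 * z * y')%R,
   (y + sgb b y')%R, (z + sgb b z')%R, b (+) b').

Definition model_one : M := (0, 0, 0, false)%R.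

Definition model_inv (g : M) : M :=
  let: (x, y, z, b) := g in
  if b then (- x - k2 * y - k3 * z + k1 * z * y - k4, y, z, true)%R
  else (- x + k1 * z * y, - y, - z, false)%R.

Let model_mulA : associative model_mul.
Proof.
move=> [[[x y] z] b] [[[x' y'] z'] b'] [[[x'' y''] z''] b''] /=.
rewrite -addbA; case: b b' b'' => [] [] [] /=; congr (_, _, _, _); ring.
Qed.

Let model_mul1 : left_id model_one model_mul.
Proof. by move=> [[[x y] z] b] /=; congr (_, _, _, _); ring. Qed.

Let model_mulr1 : right_id model_one model_mul.
Proof.
by move=> [[[x y] z] b] /=; rewrite addbF; case: b; congr (_, _, _, _) => /=; ring.
Qed.

Let model_mulVr : left_inverse model_one model_inv model_mul.
Proof. by move=> [[[x y] z] []] /=; congr (_, _, _, _); ring. Qed.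

Let model_mulrV : right_inverse model_one model_inv model_mul.
Proof. by move=> [[[x y] z] []] /=; congr (_, _, _, _); ring. Qed.

HB.instance Definition _ := isGroup.Build M
  model_mulA model_mul1 model_mulr1 model_mulVr model_mulrV.

Lemma model_mulE (g h : M) : g * h = model_mul g h. Proof. by []. Qed.

Lemma model_oneE : 1 = (0, 0, 0, false)%R :> M. Proof. by []. Qed.

Lemma model_invE (g : M) : g^-1 = model_inv g. Proof. by []. Qed.

(** The images of e1, e2, e3 and alpha. *)
Definition m1 : M := (1, 0, 0, false)%R.
Definition m2 : M := (0, 1, 0, false)%R.
Definition m3 : M := (0, 0, 1, false)%R.
Definition mA : M := (0, 0, 0, true)%R.

Lemma model_zpow_center (x : int) n :
  zpow ((x, 0, 0, false)%R : M) n = (x * n, 0, 0, false)%R.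
Proof.
elim: n => [|n IHn|n IHn]; first by rewrite mulr0.
  by rewrite -addn1 PoszD zpowS IHn model_mulE /=; congr (_, _, _, _) => /=; ring.
rewrite -addn1 PoszD opprD zpowP IHn model_invE model_mulE /=.
by congr (_, _, _, _) => /=; ring.
Qed.

Lemma model_zpow_trans (x y z : int) n :
  exists x' : int, zpow ((x, y, z, false) : M) n = (x', y * n, z * n, false)%R.
Proof.
elim: n => [|n [x' IHn]|n [x' IHn]]; first by exists 0%R; rewrite !mulr0.
  rewrite -addn1 PoszD zpowS IHn model_mulE /=.
  by eexists; congr (_, _, _, _) => /=; ring.
rewrite -addn1 PoszD opprD zpowP IHn model_invE model_mulE /=.
by eexists; congr (_, _, _, _) => /=; ring.
Qed.

Lemma model_m2X n : zpow m2 n = (0, n, 0, false)%R.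
Proof.
elim: n => [|n IHn|n IHn] //.
  by rewrite -addn1 PoszD zpowS IHn model_mulE /=; congr (_, _, _, _) => /=; ring.
rewrite -addn1 PoszD opprD zpowP IHn model_invE model_mulE /=.
by congr (_, _, _, _) => /=; ring.
Qed.

Lemma model_m3X n : zpow m3 n = (0, 0, n, false)%R.
Proof.
elim: n => [|n IHn|n IHn] //.
  by rewrite -addn1 PoszD zpowS IHn model_mulE /=; congr (_, _, _, _) => /=; ring.
rewrite -addn1 PoszD opprD zpowP IHn model_invE model_mulE /=.
by congr (_, _, _, _) => /=; ring.
Qed.

Lemma model_normal (x y z : int) (b : bool) :
  ((x, y, z, b) : M) = zpow m1 x * zpow m2 y * zpow m3 z * (if b then mA else 1).
Proof.
rewrite model_m2X model_m3X model_zpow_center !model_mulE; case: b;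
  by congr (_, _, _, _) => /=; ring.
Qed.

Section UniversalProperty.
Variables (G : groupType) (g1 g2 g3 gA : G).
Hypotheses (g21 : commute g1 g2) (g31 : commute g1 g3) (gA1 : commute g1 gA).
Hypotheses (g32 : g3 * g2 = zpow g1 k1 * g2 * g3).
Hypotheses (gA2 : gA * g2 = zpow g1 k2 * g2^-1 * gA).
Hypotheses (gA3 : gA * g3 = zpow g1 k3 * g3^-1 * gA).
Hypotheses (gAA : gA * gA = zpow g1 k4).

Let lift (g : M) : G :=
  let: (x, y, z, b) := g in
  zpow g1 x * zpow g2 y * zpow g3 z * (if b then gA else 1).

Let c1 n h : commute g1 h -> commute h (zpow g1 n).
Proof. by move=> e; apply: commute_zpow; apply: commute_sym. Qed.

Let swap32 y z : zpow g3 z * zpow g2 y = zpow g1 (k1 * z * y)%R * zpow g2 y * zpow g3 z.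
Proof.
have e3 : g3 * zpow g2 y = zpow (zpow g1 k1) y * zpow g2 y * g3.
  by apply: zpow_skew g32; apply/commute_sym/c1.
have e : zpow g2 y * g3 = (zpow g1 (- (k1 * y))%R * g3) * zpow g2 y.
  rewrite -mulgA e3 zpowN zpowM -!mulgA mulKg //.
have c3 : commute (zpow g1 (- (k1 * y))%R) g3 by apply/commute_sym/c1.
rewrite -[RHS]mulgA (zpow_skew z c3 e) -zpowM !mulgA -zpowD.
by rewrite (_ : (_ + _)%R = 0)%R ?mul1g //; ring.
Qed.

Let swapA2 y : gA * zpow g2 y = zpow g1 (k2 * y)%R * zpow g2 (- y)%R * gA.
Proof.
rewrite zpowM (zpow_skew y _ gA2); last by apply/commute_sym/c1/commuteV.
by rewrite -mulN1r zpowM zpowN1.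
Qed.

Let swapA3 y : gA * zpow g3 y = zpow g1 (k3 * y)%R * zpow g3 (- y)%R * gA.
Proof.
rewrite zpowM (zpow_skew y _ gA3); last by apply/commute_sym/c1/commuteV.
by rewrite -mulN1r zpowM zpowN1.
Qed.

Let T x y z := zpow g1 x * zpow g2 y * zpow g3 z.

Let c2 n m : commute (zpow g1 m) (zpow g2 n).
Proof. by apply/commute_sym/c1/commute_zpow. Qed.

Let c3 n m : commute (zpow g1 m) (zpow g3 n).
Proof. by apply/commute_sym/c1/commute_zpow. Qed.

Let TZ x y z w : T x y z * zpow g1 w = T (x + w)%R y z.
Proof. by rewrite /T zpowD -!mulgA -c3 (mulgA (zpow g2 y)) -c2 !mulgA. Qed.

Let TM x y z x' y' z' :
  T x y z * T x' y' z' = T (x + x' + k1 * z * y')%R (y + y')%R (z + z')%R.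
Proof.
rewrite {2}/T !mulgA TZ {1}/T -(mulgA _ (zpow g3 z)) swap32 [in RHS]/T !zpowD !mulgA.
by congr (_ * _ * _); rewrite -!mulgA; do 2!congr (_ * _); rewrite !mulgA -c2.
Qed.

Let AT x y z : gA * T x y z = T (x + k2 * y + k3 * z)%R (- y)%R (- z)%R * gA.
Proof.
rewrite /T !mulgA (c1 x gA1) -!mulgA (mulgA gA) swapA2 -!mulgA swapA3 !mulgA !zpowD.
by rewrite -!mulgA; do 2!congr (_ * _); rewrite !mulgA -c2.
Qed.

(** Four elements that satisfy the defining relations extend to a morphism on
    the coordinate group.  This yields both the inverse of the map from the
    presented group and the automorphisms with a prescribed linear part. *)
Lemma model_hom : exists F : {multiplicative M -> G},
  [/\ F m1 = g1, F m2 = g2, F m3 = g3 & F mA = gA].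
Proof.
have lift_gens : [/\ lift m1 = g1, lift m2 = g2, lift m3 = g3 & lift mA = gA].
  by split; rewrite /= ?zpow1 ?zpow0 ?mulg1 ?mul1g.
have liftE x y z b : lift (x, y, z, b) = T x y z * (if b then gA else 1) by [].
have liftM : {morph lift : g h / g * h}.
  move=> [[[x y] z] b] [[[x' y'] z'] b']; rewrite model_mulE !liftE.
  (* Otherwise rewriting with associativity would unfold [T]. *)
  clearbody T.
  case: b => /=; last by rewrite mulg1 mulgA TM.
  rewrite -!mulgA (mulgA gA). rewrite AT -!mulgA mulgA TM.
  have -> : gA * (if b' then gA else 1) =
      zpow g1 (if b' then k4 else 0)%R * (if ~~ b' then gA else 1).
    by case: b'; rewrite /= ?mulg1 ?mul1g.
  by rewrite mulgA TZ; congr (T _ _ _ * _); ring.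
by have [F FE] := mult_of liftM; exists F; rewrite FE.
Qed.

End UniversalProperty.

Lemma model_hom_ext (G : groupType) (F F' : {multiplicative M -> G}) :
  F m1 = F' m1 -> F m2 = F' m2 -> F m3 = F' m3 -> F mA = F' mA -> F =1 F'.
Proof.
move=> e1 e2 e3 eA [[[x y] z] b]; rewrite model_normal !gmulfM !mult_zpow e1 e2 e3.
by case: b; rewrite ?eA ?mult_one.
Qed.

End ModelGroup.

Arguments m1 {k1 k2 k3 k4}.
Arguments m2 {k1 k2 k3 k4}.
Arguments m3 {k1 k2 k3 k4}.
Arguments mA {k1 k2 k3 k4}.

Section WordEvaluation.
Variables (X : choiceType) (G : groupType) (f : X -> G).

Definition word_eval (w : word X) : G :=
  \prod_(l <- w) (if l.2 then (f l.1)^-1 else f l.1).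

Lemma word_eval_cat u v : word_eval (u ++ v) = word_eval u * word_eval v.
Proof. exact: big_cat. Qed.

Lemma word_eval1 x b : word_eval [:: (x, b)] = if b then (f x)^-1 else f x.
Proof. by rewrite /word_eval big_seq1. Qed.

Lemma word_eval_inv w : word_eval (word_inv w) = (word_eval w)^-1.
Proof.
elim: w => [|[x b] w IHw]; first by rewrite /word_eval !big_nil invg1.
rewrite /word_inv /= rev_cons -cats1 word_eval_cat -/(word_inv w) IHw.
rewrite -[(x, b) :: w]cat1s (word_eval_cat [:: _]) invgM !word_eval1.
by case: b; rewrite //= invgK.
Qed.

Lemma word_eval_comm u v : word_eval (word_comm u v) =
  word_eval u * word_eval v * (word_eval u)^-1 * (word_eval v)^-1.
Proof. by rewrite /word_comm !word_eval_cat !word_eval_inv !mulgA. Qed.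

Lemma word_eval_exp x n : word_eval (word_exp x n) = zpow (f x) n.
Proof.
have nseqE b k : word_eval (nseq k (x, b)) = (if b then (f x)^-1 else f x) ^+ k.
  elim: k => [|k IHk]; first by rewrite /word_eval big_nil.
  by rewrite (word_eval_cat [:: (x, b)] (nseq k _)) IHk word_eval1 expgS.
by rewrite /word_exp nseqE; case: n => n //=; rewrite expVgn.
Qed.

End WordEvaluation.

Lemma pres_class_eval (X : choiceType) (rels : seq (word X * word X)) w :
  pres_class rels w = word_eval (fun x => pres_class rels [:: (x, false)]) w.
Proof.
elim: w => [|[x b] w IHw]; first by rewrite /word_eval big_nil.
rewrite -cat1s word_eval_cat -IHw pres_class_cat word_eval1; congr (_ * _).
by case: b => //; rewrite -[RHS]pres_class_inv.
Qed.

Lemma presented_hom (X : choiceType) (rels : seq (word X * word X))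
    (G : groupType) (f : X -> G) :
  (forall u v : word X, (u, v) \in rels -> word_eval f u = word_eval f v) ->
  exists F : {multiplicative presented rels -> G},
    forall w, F (pres_class rels w) = word_eval f w.
Proof.
move=> frels.
have evalP u v : pres_cong rels u v -> word_eval f u = word_eval f v.
  elim=> {u v} [u v /frels//|x b|u u' v v' _ e _ e'|//|//|u v w _ -> _ ->//].
    rewrite -cat1s word_eval_cat !word_eval1 /word_eval big_nil.
    by case: b; rewrite /= ?mulgV ?mulVg.
  by rewrite !word_eval_cat e e'.
pose F (g : presented rels) := word_eval f (sval (cid (pres_class_surj g))).
have FE w : F (pres_class rels w) = word_eval f w.
  by rewrite /F; case: cid => v /= /pres_classP/evalP.
have FM : {morph F : g h / g * h}.
  move=> g h; have [u ->] := pres_class_surj g; have [v ->] := pres_class_surj h.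
  by rewrite -[_ * _]pres_class_cat !FE word_eval_cat.
by have [F' F'E] := mult_of FM; exists F'; rewrite F'E.
Qed.

Definition ac_relations (k1 k2 k3 k4 : int) (G : groupType) (g1 g2 g3 gA : G) :=
  [/\ commute g1 g2, commute g1 g3 & commute g1 gA] /\
  [/\ g3 * g2 = zpow g1 k1 * g2 * g3, gA * g2 = zpow g1 k2 * g2^-1 * gA,
      gA * g3 = zpow g1 k3 * g3^-1 * gA & gA * gA = zpow g1 k4].

Lemma ac_relsP (k1 k2 k3 k4 : int) (G : groupType) (f : 'I_4 -> G) :
  (forall u v : word 'I_4, (u, v) \in ac_rels k1 k2 k3 k4 ->
     word_eval f u = word_eval f v) <->
  ac_relations k1 k2 k3 k4
    (f (inord 0)) (f (inord 1)) (f (inord 2)) (f (inord 3)).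
Proof.
have comm1 (x y z : G) : x * y * x^-1 * y^-1 = z <-> x * y = z * y * x.
  by split=> [<-|->]; rewrite ?mulgVK // !mulgK.
have evalE := (word_eval_comm, word_eval_cat, word_eval_exp).
have nilE : word_eval f [::] = 1 by rewrite /word_eval big_nil.
have cons_in u v r (P : word 'I_4 -> word 'I_4 -> Prop) :
    (forall u' v', (u', v') \in (u, v) :: r -> P u' v') <->
    P u v /\ forall u' v', (u', v') \in r -> P u' v'.
  split=> [H|[H1 H2] u' v'].
    by split=> [|u' v' uv]; apply: H; rewrite inE ?eqxx ?uv ?orbT.
  by rewrite inE => /orP[/eqP[-> ->] //|]; apply: H2.
rewrite /ac_rels !cons_in /ac_relations !evalE nilE !comm1 !zpow1 zpowN1 mul1g.
rewrite -[zpow (f (inord 3)) 2]/(_ * _) !mulgA /commute.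
by split=> [[H1 [H2 [H3 [H4 [H5 [H6 [H7 _]]]]]]]|[[H1 H2 H3] [H4 H5 H6 H7]]].
Qed.

(** The coordinates are those of the presented group: the map that evaluates
    words and the one given by the universal property of the coordinate group
    are inverse to each other, since they are so on generators. *)
Lemma ac_group_iso (k1 k2 k3 k4 : int) :
  exists F : {multiplicative ac_group k1 k2 k3 k4 -> ac_model k1 k2 k3 k4},
    bijective F.
Proof.
pose M : groupType := ac_model k1 k2 k3 k4; pose rels := ac_rels k1 k2 k3 k4.
pose f (i : 'I_4) : M := nth mA [:: m1; m2; m3] i.
have [f1 f2 f3 fA] : [/\ f (inord 0) = m1, f (inord 1) = m2, f (inord 2) = m3
    & f (inord 3) = mA].
  by rewrite /f !inordK.
have [F FE] : exists F : {multiplicative presented rels -> M},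
    forall w, F (pres_class rels w) = word_eval f w.
  apply: presented_hom; apply/ac_relsP; rewrite f1 f2 f3 fA.
  split; split; rewrite /commute /m1 ?model_zpow_center !model_mulE /=;
    by congr (_, _, _, _) => /=; ring.
pose P : groupType := presented rels.
pose g i : P := pres_class rels [:: (i, false)].
have /ac_relsP[[c2 c3 cA] [r1 r2 r3 rA]] (u v : word 'I_4) :
    (u, v) \in rels -> word_eval g u = word_eval g v.
  by move=> uv; rewrite -!pres_class_eval; apply/pres_classP/pres_rel.
have [F' [e1 e2 e3 eA]] := model_hom c2 c3 cA r1 r2 r3 rA.
have FgE i : F (g i) = f i by rewrite FE word_eval1.
have [FF' FF'E] : exists F0 : {multiplicative M -> M}, F0 = F \o F' :> (M -> M).
  by apply: mult_of => x y /=; rewrite !gmulfM.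
have [id_M idE] : exists F0 : {multiplicative M -> M}, F0 = id :> (M -> M).
  by apply: mult_of.
have F'K x : F (F' x) = x.
  have : FF' =1 id_M.
    by apply: model_hom_ext; rewrite FF'E idE /= ?e1 ?e2 ?e3 ?eA FgE.
  by move/(_ x); rewrite FF'E idE.
have F'f i : F' (f i) = g i.
  rewrite -[i]inord_val; case: i => [[|[|[|[|i]]]] //= _];
  by rewrite ?f1 ?f2 ?f3 ?fA.
exists F; exists F' => // p; have [w ->] := pres_class_surj p.
rewrite FE pres_class_eval -/g; elim: w => [|[i b] w IHw].
  by rewrite /word_eval !big_nil mult_one.
rewrite -cat1s !word_eval_cat gmulfM IHw !word_eval1.
by case: b; rewrite ?mult_inv F'f.
Qed.

(** * Automorphisms of the group *)

(** The exponent of the square of e2^y e3^z alpha, a central element. *)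
Definition qform (k1 k2 k3 k4 y z : int) : int := (k2 * y + k3 * z - k1 * z * y + k4)%R.

Section Automorphisms.
Variables k1 k2 k3 k4 : int.
Local Notation M := (ac_model k1 k2 k3 k4).
Local Notation q := (qform k1 k2 k3 k4).
Implicit Types (phi : {multiplicative M -> M}) (g h : M).

Lemma model_centerM (x y z n : int) (b : bool) :
  ((x, y, z, b) : M) * ((n, 0, 0, false)%R : M) = (x + n, y, z, b)%R.
Proof. by rewrite model_mulE /= addbF; case: b; congr (_, _, _, _) => /=; ring. Qed.

Lemma model_Mcenter (x y z n : int) (b : bool) :
  ((n, 0, 0, false)%R : M) * ((x, y, z, b) : M) = (n + x, y, z, b)%R.
Proof. by rewrite model_mulE /=; congr (_, _, _, _) => /=; ring. Qed.

Lemma model_centerC (n : int) g :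
  ((n, 0, 0, false)%R : M) * g = g * ((n, 0, 0, false)%R : M).
Proof. by case: g => [[[x y] z] b]; rewrite model_centerM model_Mcenter addrC. Qed.

Lemma model_sqr (x y z : int) :
  ((x, y, z, true) : M) * ((x, y, z, true) : M) = (2 * x + q y z, 0, 0, false)%R.
Proof. by rewrite model_mulE /qform /=; congr (_, _, _, _) => /=; ring. Qed.

(** The automorphism acts by [nu] on the centre <e1>, by the matrix with columns
    (a, b) and (c, d) on Z^2, and sends alpha into the coset of (s, t) alpha;
    the e1-coordinates of the images of e2, e3 and alpha stay unspecified. *)
Definition induces phi (nu a b c d s t : int) :=
  (forall x : int, phi (x, 0, 0, false)%R = (nu * x, 0, 0, false)%R) /\
  forall (x y z : int) (e : bool), exists x' : int,
    phi (x, y, z, e) = (x', a * y + c * z + (if e then s else 0),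
                        b * y + d * z + (if e then t else 0), e)%R.

Lemma induces_gens phi (nu a b c d s t p r u : int) :
  phi m1 = (nu, 0, 0, false)%R -> phi m2 = (p, a, b, false) ->
  phi m3 = (r, c, d, false) -> phi mA = (u, s, t, true) ->
  induces phi nu a b c d s t.
Proof.
move=> e1 e2 e3 eA; split=> [x|x y z e].
  have -> : (x, 0, 0, false)%R = zpow m1 x :> M.
    by rewrite model_zpow_center mul1r.
  by rewrite mult_zpow e1 model_zpow_center.
rewrite model_normal !gmulfM !mult_zpow e1 e2 e3 model_zpow_center.
have [x2 ->] := model_zpow_trans k1 k2 k3 k4 p a b y.
have [x3 ->] := model_zpow_trans k1 k2 k3 k4 r c d z.
case: e; rewrite ?eA ?mult_one ?model_oneE !model_mulE /=.
  by eexists; congr (_, _, _, _) => /=; ring.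
by eexists; congr (_, _, _, _) => /=; ring.
Qed.

Section InducedAction.
Variables (phi : {multiplicative M -> M}) (nu a b c d s t : int).
Hypothesis phiP : induces phi nu a b c d s t.

(** Apply the automorphism to [e3, e2] = e1^k1. *)
Lemma induces_det : (0 < k1 -> nu = a * d - b * c)%R.
Proof.
move=> k1_gt0; have [phi1 phiv] := phiP.
have [x2 e2] := phiv 0%R 1%R 0%R false; have [x3 e3] := phiv 0%R 0%R 1%R false.
have : phi (m3 * m2) = phi ((k1, 0, 0, false)%R : M) * phi m2 * phi m3.
  rewrite -!gmulfM; congr (phi _); rewrite !model_mulE /=.
  by congr (_, _, _, _) => /=; ring.
rewrite gmulfM phi1 e2 e3 !model_mulE /= => -[e _ _].
have k0 : k1 != 0%R by lia.
by apply: (mulfI k0); move: e; rewrite !(mulr0, mulr1, addr0, add0r, mul0r); lia.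
Qed.

(** Apply the automorphism to (e2^y e3^z alpha)^2 = e1^q(y, z). *)
Lemma induces_qform y z :
  exists x : int, (2 * x + q (a * y + c * z + s) (b * y + d * z + t) = nu * q y z)%R.
Proof.
have [phi1 phiv] := phiP; have [x e] := phiv 0%R y z true; exists x.
have := phi1 (2 * 0 + q y z)%R.
by rewrite -model_sqr gmulfM e model_sqr => -[->]; rewrite mulr0 add0r.
Qed.

(** If [h = (x, y, z) alpha] stabilises [g] up to e1^n, then [phi h] is a
    conjugate of [h] times e1^n.  Square this: [h * h] is the central element
    of exponent 2 x + q(y, z), so conjugation disappears. *)
Lemma induces_stabilizer (g : M) (x y z n : int) :
  g * phi (x, y, z, true) = ((x, y, z, true) : M) * g * ((n, 0, 0, false)%R : M) ->
  ((nu - 1) * (2 * x + q y z) = 2 * n)%R.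
Proof.
have [phi1 phiv] := phiP; set h : M := (x, y, z, true); set e : M := (n, 0, 0, false)%R.
move=> gh; have ce g' : e * g' = g' * e by exact: model_centerC.
have : g * phi (h * h) = h * h * e * e * g.
  rewrite gmulfM mulgA gh -(mulgA (h * g)) ce !mulgA -(mulgA h g) gh -!mulgA.
  by do 2!congr (_ * _); rewrite (ce g) !mulgA (ce g).
have -> : h * h = (2 * x + q y z, 0, 0, false)%R by exact: model_sqr.
rewrite phi1 /e !model_centerM; case: g {gh} => [[[x' y'] z'] b'].
by rewrite model_centerM model_Mcenter => -[]; lia.
Qed.

End InducedAction.

Definition central g := forall h, g * h = h * g.

Lemma centralP (x y z : int) (b : bool) :
  central (x, y, z, b) <-> [/\ y = 0, z = 0 & b = false]%R.
Proof.
split=> [H|[-> -> ->] [[[x' y'] z'] b']]; last exact: model_centerC.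
have := H mA; have := H m2; rewrite !model_mulE /=; case: b {H} => /=.
  by move=> [_]; lia.
by move=> _ [_]; rewrite !addr0 !add0r => ? ?; split=> //; lia.
Qed.

(** The elements outside the translation subgroup are the non-central elements
    with central square; thus automorphisms preserve that subgroup. *)
Lemma bitP g : g.2 <-> central (g * g) /\ ~ central g.
Proof.
case: g => [[[x y] z] []] /=.
  by split=> // _; rewrite model_sqr !centralP; split=> // -[].
split=> // -[]; rewrite model_mulE /= !centralP => -[y0 z0 _] []; split=> //; lia.
Qed.

Lemma aut_induces phi : bijective phi ->
  exists nu a b c d s t : int, induces phi nu a b c d s t /\ (nu = 1 \/ nu = -1)%R.
Proof.
move=> [psi phiK psiK].
have phiC g : central (phi g) <-> central g.
  split=> H h; first by apply: (can_inj phiK); rewrite !gmulfM H.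
  by rewrite -[h]psiK -!gmulfM H.
have phibit g : (phi g).2 = g.2.
  by apply/idP/idP; rewrite -/(is_true _) -/(is_true _) !bitP -gmulfM !phiC.
have cm1 : central m1 by apply/centralP.
case e1 : (phi m1) ((phiC m1).2 cm1) => [[[nu y] z] b] /centralP[y0 z0 b0].
case e2 : (phi m2) (phibit m2) => [[[x2 a] b'] bb] /= bb0.
case e3 : (phi m3) (phibit m3) => [[[x3 c] d] bc] /= bc0.
case eA : (phi mA) (phibit mA) => [[[xA s] t] bd] /= bd0.
move: e1 e2 e3 eA; rewrite y0 z0 b0 bb0 bc0 bd0 => e1 e2 e3 eA.
have phiI := induces_gens e1 e2 e3 eA.
exists nu, a, b', c, d, s, t; split=> //.
have := psiK m1; case ep : (psi m1) => [[[x y'] z'] b1].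
have : central (psi m1) by apply/phiC; rewrite psiK.
rewrite ep centralP => -[-> -> ->]; rewrite phiI.1 => -[] /(congr1 absz)/eqP.
by rewrite abszM muln_eq1 => /andP[/eqP ? _]; lia.
Qed.

Lemma induces_bijective phi (a b c d s t : int) :
  (a * d - b * c = -1)%R -> induces phi (-1) a b c d s t -> bijective phi.
Proof.
move=> det [phi1 phiv].
have phi_surj g : exists h, phi h = g.
  case: g => [[[x y] z] e].
  pose y' : int := (if e then y - s else y)%R.
  pose z' : int := (if e then z - t else z)%R.
  have [x' e'] := phiv 0%R (c * z' - d * y')%R (b * y' - a * z')%R e.
  exists (((x' - x, 0, 0, false)%R : M) *
    ((0, c * z' - d * y', b * y' - a * z', e)%R : M)).
  rewrite gmulfM phi1 e' model_Mcenter; congr (_, _, _, _); first by ring.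
    have -> : (a * (c * z' - d * y') + c * (b * y' - a * z') =
      - (a * d - b * c) * y')%R by ring.
    by rewrite det /y'; case: (e); ring.
  have -> : (b * (c * z' - d * y') + d * (b * y' - a * z') =
    - (a * d - b * c) * z')%R by ring.
  by rewrite det /z'; case: (e); ring.
have phi_ker g : phi g = 1 -> g = 1.
  case: g => [[[x y] z] e]; have [x' e'] := phiv x y z e; rewrite e' => -[x'0 ey ez e0].
  move: ey ez e'; rewrite x'0 e0 !addr0 => ey ez.
  have y0 : y = 0%R.
    have -> : (y = - (d * (a * y + c * z) - c * (b * y + d * z)) )%R.
      rewrite -[LHS]mul1r -[1%R]opprK -det; ring.
    by rewrite ey ez; ring.
  have z0 : z = 0%R.
    have -> : (z = - (a * (b * y + d * z) - b * (a * y + c * z)))%R.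
      rewrite -[LHS]mul1r -[1%R]opprK -det; ring.
    by rewrite ey ez; ring.
  rewrite y0 z0 phi1 => -[ex _ _].
  by have -> : x = 0%R by lia.
have phi_inj : injective phi.
  move=> g h e; apply: (@mulIg _ h^-1); rewrite mulgV; apply: phi_ker.
  by rewrite gmulfM mult_inv e mulgV.
pose psi g := sval (cid (phi_surj g)).
have psiK : cancel psi phi by move=> g; exact: (svalP (cid (phi_surj g))).
by exists psi => // g; apply: phi_inj; rewrite psiK.
Qed.

(** The relations between the images of the generators fix twice the
    e1-coordinates of these images.  The required halves exist precisely because
    q is preserved modulo 2 at the points (0, 0), (1, 0) and (0, 1). *)
Lemma aut_exists (a b c d s t : int) :
  (a * d - b * c = -1)%R ->
  (forall y z : int, par (q (a * y + c * z + s) (b * y + d * z + t))%R = par (q y z)) ->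
  exists2 phi : {multiplicative M -> M}, bijective phi & induces phi (-1) a b c d s t.
Proof.
move=> det qP.
have half y z : exists x : int,
    (2 * x + q (a * y + c * z + s) (b * y + d * z + t) = - q y z)%R.
  have /par_eq[k e] := qP y z.
  by exists (- k - q y z)%R; rewrite e; ring.
have [u eA] := half 0%R 0%R; have [p' e2] := half 1%R 0%R; have [r' e3] := half 0%R 1%R.
have {}eA : (2 * u + k2 * s + k3 * t - k1 * t * s + k4 = - k4)%R.
  by move: eA; rewrite /qform; lia.
have [p {}e2] : exists p : int,
    (2 * p + k2 * a + k3 * b + k1 * (b * s - t * a) - k1 * a * b = - k2)%R.
  by exists (p' - u - k1 * b * s)%R; move: e2 eA; rewrite /qform; nia.
have [r {}e3] : exists r : int,
    (2 * r + k2 * c + k3 * d + k1 * (d * s - t * c) - k1 * c * d = - k3)%R.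
  by exists (r' - u - k1 * d * s)%R; move: e3 eA; rewrite /qform; nia.
have [phi [f1 f2 f3 fA]] : exists phi : {multiplicative M -> M},
    [/\ phi m1 = (-1, 0, 0, false)%R, phi m2 = (p, a, b, false),
        phi m3 = (r, c, d, false) & phi mA = (u, s, t, true)].
  apply: model_hom; rewrite /commute ?model_zpow_center ?model_invE !model_mulE /=;
    congr (_, _, _, _) => /=; try by ring.
  - have : (k1 * (a * d - b * c) = - k1)%R by rewrite det mulrN1.
    lia.
  - lia.
  - lia.
  - lia.
have phiI := induces_gens f1 f2 f3 fA.
by exists phi => //; exact: induces_bijective phiI.
Qed.

End Automorphisms.

(** * Automorphisms with infinite Reidemeister number *)

Section InfiniteReidemeister.
Variables k1 k2 k3 k4 : int.
Local Notation M := (ac_model k1 k2 k3 k4).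
Variables (phi : {multiplicative M -> M}) (nu a b c d s t : int).
Hypothesis phiP : induces phi nu a b c d s t.

Lemma twist_coords (x y z m u v x' y' z' : int) (e b' e' : bool) :
  ((x, y, z, e) : M) * phi (m, u, v, b') =
    ((m, u, v, b') : M) * ((x', y', z', e') : M) ->
  [/\ e' = e,
      y + sgb e (a * u + c * v + (if b' then s else 0)) = u + sgb b' y' &
      z + sgb e (b * u + d * v + (if b' then t else 0)) = v + sgb b' z']%R.
Proof.
have [_ phiv] := phiP; have [x'' ->] := phiv m u v b'.
rewrite !model_mulE /= => -[_ -> -> e1].
by split=> //; move: e1; case: e b' e' => [] [] [].
Qed.

(** A non-zero covector (f1, f2) with (f1, f2) (1 - L) = 0 is an invariant of
    twisted conjugation by translations, and alpha changes it to its opposite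
    minus the constant [w].  On far enough multiples of (f1, f2) it therefore
    separates all classes. *)
Lemma reidemeister_singular : ((1 - a) * (1 - d) - b * c = 0)%R ->
  reidemeister_number phi = None.
Proof.
move=> det0.
have [f1 [f2 [fn1 fn2 fpos]]] : exists f1 f2 : int,
    [/\ f1 * (1 - a) = f2 * b, f2 * (1 - d) = f1 * c & 0 < f1 * f1 + f2 * f2]%R.
  (* If both rows of the adjugate matrix of 1 - L vanish, then L = 1. *)
  have sq (x y : int) : ((x == 0) && (y == 0) = false -> 0 < x * x + y * y)%R.
    by case: eqP => [->|]; case: eqP => //; nia.
  case e1 : ((b == 0) && (1 - a == 0))%R; last first.
    exists b, (1 - a)%R; split; [ring|lia|exact: sq].
  case e2 : ((1 - d == 0) && (c == 0))%R; last first.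
    exists (1 - d)%R, c; split; [lia|ring|exact: sq].
  exists 1%R, 0%R; split; lia.
pose S := (f1 * f1 + f2 * f2)%R; pose w := (f1 * s + f2 * t)%R.
pose N (i : nat) : int := (i%:Z + `|w| + 1)%R.
apply: (@reidemeister_number_None _ _
  (fun i => ((0, N i * f1, N i * f2, false)%R : M))).
move=> i j /twisted_conjP[[[[m u] v] []]] /twist_coords[_] /= ey ez.
  have : ((N i + N j) * S = - w)%R.
    rewrite /S /w.
    transitivity (f1 * ((N i + N j) * f1) + f2 * ((N i + N j) * f2))%R; first by ring.
    have -> : ((N i + N j) * f1 = (1 - a) * u - c * v - s)%R by lia.
    have -> : ((N i + N j) * f2 = (1 - d) * v - b * u - t)%R by lia.
    transitivity ((f1 * (1 - a) - f2 * b) * u + (f2 * (1 - d) - f1 * c) * v -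
      (f1 * s + f2 * t))%R; first by ring.
    by rewrite fn1 fn2; ring.
  by rewrite /N -/S in fpos *; nia.
have : ((N i - N j) * S = 0)%R.
  rewrite /S.
  transitivity (f1 * ((N i - N j) * f1) + f2 * ((N i - N j) * f2))%R; first by ring.
  have -> : ((N i - N j) * f1 = (1 - a) * u - c * v)%R by lia.
  have -> : ((N i - N j) * f2 = (1 - d) * v - b * u)%R by lia.
  transitivity ((f1 * (1 - a) - f2 * b) * u + (f2 * (1 - d) - f1 * c) * v)%R.
    by ring.
  by rewrite fn1 fn2; ring.
rewrite -/S in fpos; move=> /eqP; rewrite mulf_eq0 (gt_eqF fpos) orbF /N; lia.
Qed.

(** If 1 - L is regular, the powers of e1 are pairwise inequivalent: a
    translation that relates two of them is central, hence fixed by phi, and an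
    element h outside N that relates them satisfies [induces_stabilizer], where
    the factor nu - 1 vanishes. *)
Lemma reidemeister_central : nu = 1%R -> reidemeister_number phi = None.
Proof.
move=> nu1; have [phi1 _] := phiP.
have [/eqP/reidemeister_singular//|det] := boolP ((1 - a) * (1 - d) - b * c == 0)%R.
apply: (@reidemeister_number_None _ _ (fun i => ((i%:Z, 0, 0, false)%R : M))).
move=> i j /twisted_conjP[[[[m u] v] []]] e.
  have := induces_stabilizer phiP (g := 1) (x := m) (y := u) (z := v)
    (n := (j%:Z - i%:Z)%R).
  rewrite mul1g mulg1 nu1 model_centerM subrr mul0r => H.
  suff : (0 = 2 * (j%:Z - i%:Z))%R by lia.
  apply: H; apply: (@mulgI _ ((i%:Z, 0, 0, false)%R : M)).
  rewrite e model_centerM model_Mcenter.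
  by congr (_, _, _, _); ring.
have [_ /= ey ez] := twist_coords e.
have [u0 v0] : (u = 0 /\ v = 0)%R.
  by apply: (@linear_inj (1 - a) (- b) (- c) (1 - d)); rewrite ?mulrNN //; lia.
by move: e; rewrite u0 v0 phi1 nu1 !model_centerM => -[]; lia.
Qed.

End InfiniteReidemeister.

(** * Automorphisms with finite Reidemeister number *)

Section FiniteCount.
Variables k1 k2 k3 k4 : int.
Local Notation M := (ac_model k1 k2 k3 k4).
Local Notation q := (qform k1 k2 k3 k4).
Implicit Types (g h : M).

(** The zeros of q modulo 2 that the affine map u -> L u + w fixes modulo 2. *)
Definition fixed_mod2 (a b c d s t : int) (u : bool * bool) : bool :=
  let y : int := u.1%:R%R in let z : int := u.2%:R%R in
  [&& par (a * y + c * z + s)%R == u.1, par (b * y + d * z + t)%R == u.2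
    & ~~ par (q y z)].

Variables (phi : {multiplicative M -> M}) (a b c d s t : int).
Hypothesis phiP : induces phi (-1)%R a b c d s t.
Hypothesis det : (a * d - b * c = -1)%R.
Hypothesis tr_neq0 : (a + d != 0)%R.

Let trans (g : M) := g.2 = false.
Let E0 := twisted_by trans phi.

Let E0_equiv : [/\ forall g, E0 g g, forall g h, E0 g h -> E0 h g &
  forall g1 g2 g3, E0 g1 g2 -> E0 g2 g3 -> E0 g1 g3].
Proof.
apply: twisted_by_equiv => //.
  by move=> [[[x y] z] e]; rewrite /trans /= => ->.
by move=> [[[x y] z] e] [[[x' y'] z'] e']; rewrite /trans /= => -> ->.
Qed.

(** The matrix is 1 - L on N and 1 + L on the coset N alpha. *)
Let detB e : ((1 - sgb e a) * (1 - sgb e d) - (- sgb e b) * (- sgb e c) =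
  - sgb e (a + d))%R.
Proof.
transitivity (1 - sgb e (a + d) + (a * d - b * c))%R; last by rewrite det; ring.
by case: e => /=; ring.
Qed.

Let injB e (u v : int) : (u - sgb e (a * u + c * v) = 0 ->
  v - sgb e (b * u + d * v) = 0 -> u = 0 /\ v = 0)%R.
Proof.
move=> eu ev.
apply: (@linear_inj (1 - sgb e a) (- sgb e b) (- sgb e c) (1 - sgb e d))%R.
- by rewrite detB; case: e {eu ev} => /=; lia.
- by rewrite -eu; case: e {eu ev} => /=; ring.
- by rewrite -ev; case: e {eu ev} => /=; ring.
Qed.

(** Over the same point of Z^2 only central translations can act, because 1 - L
    and 1 + L are injective, and e1^m shifts the first coordinate by 2 m. *)
Let E0_same (x x' y z : int) e : E0 (x, y, z, e) (x', y, z, e) <-> par x = par x'.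
Proof.
have [phi1 _] := phiP; rewrite par_eq; split.
  move=> [[[[m u] v] e'] /= e'0 E]; rewrite /trans /= in e'0; rewrite e'0 in E.
  have [_ /= ey ez] := twist_coords phiP E.
  have [u0 v0] : (u = 0 /\ v = 0)%R.
    by apply: (@injB e); rewrite !addr0 in ey ez; lia.
  move: E; rewrite u0 v0 phi1 model_centerM model_Mcenter => -[E].
  by exists m; lia.
move=> [m ->]; exists (m, 0, 0, false)%R => //.
by rewrite phi1 model_centerM model_Mcenter; congr (_, _, _, _); ring.
Qed.

Let E0_move (x y z u v : int) e : exists x' : int,
  E0 (x, (y + (u - sgb e (a * u + c * v)))%R,
         (z + (v - sgb e (b * u + d * v)))%R, e) (x', y, z, e).
Proof.
have [_ phiv] := phiP; pose h : M := (0%R, u, v, false).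
set g : M := (x, _, _, e); case E : (h^-1 * (g * phi h)) => [[[x' y'] z'] e'].
have {}E : g * phi h = h * ((x', y', z', e') : M) by rewrite -E mulVKg.
have [ee ey ez] := twist_coords phiP E.
have <- : y' = y by move: ey; rewrite /= addr0; lia.
have <- : z' = z by move: ez; rewrite /= addr0; lia.
by exists x', h => //; rewrite -ee.
Qed.

(** The class of a point of Z^2 modulo the image of 1 - L or 1 + L, together with
    the parity of the first coordinate after moving the point to the chosen
    representative of its class. *)
Let coset_classes e : exists (F : finType) (c0 : int * (int * int) -> F),
  #|F| = (2 * `|(a + d)%R|)%N /\
  classifies (fun v v' => E0 (v.1, v.2.1, v.2.2, e) (v'.1, v'.2.1, v'.2.2, e)) c0.
Proof.
have [Erefl Esym Etrans] := E0_equiv.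
have [|F [r [cardF [rS rE]]]] :=
  @plane_index (1 - sgb e a)%R (- sgb e b)%R (- sgb e c)%R (1 - sgb e d)%R.
  by rewrite detB; case: e => /=; lia.
pose sec v := sval (cid (rS (r v))).
have r_sec v : r (sec v) = r v := svalP (cid (rS (r v))).
have sec_eq v v' : r v = r v' -> sec v = sec v' by rewrite /sec => ->.
have rP v v' : r v = r v' <-> exists u1 u2 : int,
    v = (v'.1 + (u1 - sgb e (a * u1 + c * u2)),
         v'.2 + (u2 - sgb e (b * u1 + d * u2)))%R.
  rewrite rE; split=> -[u1 [u2 ->]]; exists u1, u2; congr (_, _); case: (e) => /=; ring.
have red x v : exists x0 : int, E0 (x, v.1, v.2, e) (x0, (sec v).1, (sec v).2, e).
  have /rP[u1 [u2 ev]] := esym (r_sec v); 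
  by case: v (sec v) ev => v1 v2 [w1 w2] /= [-> ->]; exact: E0_move.
pose x0 x v := sval (cid (red x v)).
have x0P x v : E0 (x, v.1, v.2, e) (x0 x v, (sec v).1, (sec v).2, e) :=
  svalP (cid (red x v)).
exists (bool * F)%type, (fun p => (par (x0 p.1 p.2), r p.2)).
split.
  by rewrite card_prod card_bool cardF detB; case: (e) => /=; rewrite ?opprK ?abszN.
split=> [[p f]|[x v] [x' v'] /=].
  have [v fE] := rS f; exists (p%:R%R, sec v); rewrite /= r_sec fE; congr (_, _).
  have /E0_same <- : E0 (p%:R%R, (sec v).1, (sec v).2, e)
      (x0 p%:R%R (sec v), (sec v).1, (sec v).2, e).
    by have := x0P p%:R%R (sec v); rewrite (sec_eq (sec v) v).
  by case: p.
split=> [[ex er]|E].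
  apply: (Etrans _ _ _ (x0P x v)); apply: (Etrans _ _ _ _ (Esym _ _ (x0P x' v'))).
  by rewrite (sec_eq _ _ er); apply/E0_same.
have er : r v = r v'.
  case: E => -[[[m u1] u2] e'] /= e'0; rewrite /trans /= in e'0; rewrite e'0.
  move=> /(twist_coords phiP)[_ /= ey ez]; apply/rP; exists u1, u2.
  by case: v ey ez => v1 v2 /= ey ez; rewrite !addr0 in ey ez; congr (_, _); lia.
congr (_, _) => //; apply/(@E0_same _ _ (sec v).1 (sec v).2 e).
apply: (Etrans _ _ _ (Esym _ _ (x0P x v))); apply: (Etrans _ _ _ E).
by rewrite (sec_eq _ _ er).
Qed.

Let translation_classes : exists (F : finType) (c0 : M -> F),
  #|F| = (4 * `|(a + d)%R|)%N /\ classifies E0 c0.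
Proof.
have [F1 [c1 [card1 [c1S c1E]]]] := coset_classes true.
have [F0 [c0 [card0 [c0S c0E]]]] := coset_classes false.
exists (F1 + F0)%type, (fun g : M => let: (x, y, z, e) := g in
  if e then inl (c1 (x, (y, z))) else inr (c0 (x, (y, z)))).
split; first by rewrite card_sum card1 card0; lia.
split=> [[f|f]|[[[x y] z] e] [[[x' y'] z'] e']].
- by have [[x [y z]] <-] := c1S f; exists (x, y, z, true).
- by have [[x [y z]] <-] := c0S f; exists (x, y, z, false).
have eE : E0 (x, y, z, e) (x', y', z', e') -> e' = e.
  by case=> -[[[m u] v] b'] _ /(twist_coords phiP)[].
case: e e' eE => [] [] eE; try by split=> [//|/eE].
- by split=> [[/c1E]//|E]; congr inl; apply/c1E.
- by split=> [[/c0E]//|E]; congr inr; apply/c0E.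
Qed.

(** Twisted conjugation by alpha. *)
Let flip (g : M) : M := mA * g * (phi mA)^-1.

Let E0_flip g : E0 g (flip g) <-> exists2 h : M, h.2 & g * phi h = h * g.
Proof.
split=> -[h hb E].
  exists (h * mA); first by case: h hb {E} => [[[x y] z] e]; rewrite /trans /= => ->.
  by rewrite gmulfM mulgA E /flip !mulgA mulgVK.
exists (h * mA^-1); first by case: h hb {E} => [[[x y] z] []].
by rewrite gmulfM mult_inv mulgA E /flip -!mulgA mulKg.
Qed.

Let fixed_point_halving (y z u v : int) e : (2 * y = u - sgb e (a * u + c * v + s))%R ->
  (2 * z = v - sgb e (b * u + d * v + t))%R ->
  par (a * u + c * v + s)%R = par u /\ par (b * u + d * v + t)%R = par v.
Proof.
move=> ey ez; split; apply/par_eq.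
  by exists (if e then y - u else - y)%R; case: e ey {ez} => /=; lia.
by exists (if e then z - v else - z)%R; case: e ez {ey} => /=; lia.
Qed.

(** The congruence on v says that u alpha stabilises the class of (y, z) in Z^2.
    The remaining shift along e1 is - q(u), and multiplying u alpha by e1^m
    changes it by an even number. *)
Let E0_flip_coords (x y z : int) e : E0 (x, y, z, e) (flip (x, y, z, e)) <->
  exists u v : int, [/\ 2 * y = u - sgb e (a * u + c * v + s),
                       2 * z = v - sgb e (b * u + d * v + t) & ~~ par (q u v)]%R.
Proof.
rewrite E0_flip; split=> [[[[[m u] v] e'] /= e'1 E]|[u [v [ey ez qe]]]].
  rewrite e'1 in E; have [_ /= ey ez] := twist_coords phiP E.
  exists u, v; split; [lia|lia|].
  have /(induces_stabilizer phiP) : ((x, y, z, e) : M) * phi (m, u, v, true) =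
     ((m, u, v, true) : M) * ((x, y, z, e) : M) * ((0, 0, 0, false)%R : M).
    by rewrite E; symmetry; apply: mulg1.
  rewrite mulr0 => H; have -> : q u v = (2 * - m)%R by lia.
  by rewrite parM.
have [phi1 phiv] := phiP; have [r er] := phiv 0%R u v true.
pose g : M := (x, y, z, e); pose h0 : M := (0%R, u, v, true).
have [X1 e1] : exists X1 : int, g * phi h0 = (X1, u - y, v - z, ~~ e)%R.
  rewrite er /g /h0 !model_mulE /= addbT.
  by eexists; congr (_, _, _, _); move: ey ez; case: (e) => /=; lia.
have [X2 e2] : exists X2 : int, h0 * g = (X2, u - y, v - z, ~~ e)%R.
  by rewrite /g /h0 !model_mulE /=; eexists; congr (_, _, _, _).
have E : g * phi h0 = h0 * g * (((X1 - X2)%R, 0, 0, false)%R : M).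
  by rewrite e1 e2 model_centerM; congr (_, _, _, _); ring.
have qX := induces_stabilizer phiP E.
have [k qk] := parP (q u v); rewrite (negbTE qe) addr0 in qk.
exists ((((- k)%R, 0, 0, false)%R : M) * h0) => //.
rewrite gmulfM phi1 mulgA -model_centerC -mulgA E -[RHS]mulgA.
by rewrite -/g !e2 model_centerM !model_Mcenter; congr (_, _, _, _); lia.
Qed.

(** A fixed class is determined by its coset of N, a parity, and u modulo 2,
    where u alpha is the part outside N of its stabiliser; changing the
    representative of the class by a translation changes u by an element of
    2 Z^2.  The coordinates (ry, rz) solve 2 v = u - L u - w on N and
    2 v = u + L u + w on N alpha. *)
Let fixed_classes (F : finType) (c0 : M -> F) (p : pred F) : classifies E0 c0 ->
  (forall g, p (c0 g) <-> E0 g (flip g)) ->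
  #|p| = (4 * #|fixed_mod2 a b c d s t|)%N.
Proof.
move=> [c0S c0E] pP; have [Erefl Esym Etrans] := E0_equiv.
pose P := fixed_mod2 a b c d s t; pose T : finType := {u : bool * bool | P u}.
pose ry (e : bool) (u v : int) : int := ((u - sgb e (a * u + c * v + s)) %/ 2)%Z.
pose rz (e : bool) (u v : int) : int := ((v - sgb e (b * u + d * v + t)) %/ 2)%Z.
have halfK (x : int) : par x = false -> (2 * (x %/ 2)%Z = x)%R.
  by move=> px; have [k ->] := parP x; rewrite px addr0 [(2 * k)%R]mulrC mulzK // mulrC.
have par_sgb e (x : int) : par (sgb e x) = par x by case: e; rewrite //= parN.
have rP e (u : bool * bool) : P u ->
  (2 * ry e u.1%:R u.2%:R = u.1%:R - sgb e (a * u.1%:R + c * u.2%:R + s))%R /\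
  (2 * rz e u.1%:R u.2%:R = u.2%:R - sgb e (b * u.1%:R + d * u.2%:R + t))%R.
  have par_bool (x : bool) : par x%:R%R = x by case: x.
  move=> /and3P[/eqP e1 /eqP e2 _]; split; apply: halfK; rewrite parD parN par_sgb.
    by rewrite e1 par_bool addbb.
  by rewrite e2 par_bool addbb.
pose rep (i : bool * bool * T) : M :=
  let u := val i.2 in
  (i.1.2%:R%R, ry i.1.1 u.1%:R%R u.2%:R%R, rz i.1.1 u.1%:R%R u.2%:R%R, i.1.1).
have rep_inj : injective (c0 \o rep).
  move=> [[e x] [u Pu]] [[e' x'] [u' Pu']] /c0E E.
  have ee : e' = e by case: E => [[[[m v] w] b']] _ /(twist_coords phiP)[].
  move: E; rewrite /rep /= ee => E.
  have [ey ez] := rP e u Pu; have [ey' ez'] := rP e u' Pu'.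
  have uu : u = u'.
    case: E => [[[[m v] w] b']] /= b'0; rewrite /trans /= in b'0; rewrite b'0.
    move=> /(twist_coords phiP)[_ /= hy hz]; rewrite !addr0 in hy hz.
    have [vv ww] : ((u.1%:R - u'.1%:R - 2 * v = 0 :> int) /\
        (u.2%:R - u'.2%:R - 2 * w = 0 :> int))%R.
      by apply: (@injB e); case: (e) ey ez ey' ez' hy hz => /=; lia.
    case: u u' {Pu Pu' ey ez ey' ez' hy hz} vv ww => [u1 u2] [u1' u2'] /=.
    by case: u1 u2 u1' u2' => [] [] [] [] //= vv ww; exfalso; lia.
  case: _ / uu Pu' E {ey' ez'} => Pu' /E0_same.
  have -> : par x%:R%R = x by case: (x).
  have -> : par x'%:R%R = x' by case: (x').
  by move=> ->; congr (_, _); apply: val_inj.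
have cardT : #|T| = #|P| by rewrite card_sig.
have -> : #|p| = #|codom (c0 \o rep)|.
  apply: eq_card => f; apply/idP/codomP => [pf|[[[e x] [u Pu]] ->]].
    have [[[[x y] z] e] fE] := c0S f.
    have : p f := pf; rewrite -fE => /pP/E0_flip_coords[v [w [ey ez qe]]].
    have [pv pw] := fixed_point_halving ey ez.
    have [k vk] := parP v; have [l wl] := parP w.
    have Pu : P (par v, par w).
      have par_aff (f1 f2 f3 : int) : par (f1 * (par v)%:R + f2 * (par w)%:R + f3)%R =
          par (f1 * v + f2 * w + f3)%R.
        by rewrite {2}vk {2}wl !parE; case: (par v); case: (par w).
      rewrite /P /fixed_mod2 /= !par_aff pv pw !eqxx /=; move: qe.
      by rewrite {1}vk {1}wl /qform !parE; case: (par v); case: (par w).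
    have [ey' ez'] := rP e _ Pu; rewrite /= in ey' ez'.
    have [x' E] := E0_move x (ry e (par v)%:R (par w)%:R)%R
      (rz e (par v)%:R (par w)%:R)%R k l e.
    exists (e, par x', Sub (par v, par w) Pu); rewrite /= /rep /=; apply/c0E.
    have ex' : E0 (x', ry e (par v)%:R (par w)%:R, rz e (par v)%:R (par w)%:R, e)%R
      ((par x')%:R, ry e (par v)%:R (par w)%:R, rz e (par v)%:R (par w)%:R, e)%R.
      by apply/E0_same; case: (par x').
    apply: Etrans ex'; move: E; congr (E0 (_, _, _, _) _).
      by case: (e) ey ey' => /=; lia.
    by case: (e) ez ez' => /=; lia.
  have [ey ez] := rP e u Pu; apply/pP/E0_flip_coords; exists u.1%:R%R, u.2%:R%R.
  by split=> //; case/and3P: Pu.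
by rewrite card_codom // !card_prod card_bool cardT.
Qed.

(** Orbits of alpha on the classes modulo N, by [involution_orbits]. *)
Lemma reidemeister_finite :
  reidemeister_number phi = Some (2 * (`|(a + d)%R| + #|fixed_mod2 a b c d s t|))%N.
Proof.
have [F [c0 [cardF c0P]]] := translation_classes.
pose p : pred F := fun f => `[< exists2 g, c0 g = f & E0 g (flip g) >].
have [Erefl Esym Etrans] := E0_equiv.
have flipE g g' : E0 g g' -> E0 (flip g) (flip g').
  move=> [h hb E]; exists (mA * h * mA^-1).
    by case: h hb {E} => [[[x y] z] e]; rewrite /trans /= => ->.
  rewrite /flip !gmulfM mult_inv -!mulgA !mulKg; congr (_ * _).
  by rewrite !mulgA E.
have pP g : p (c0 g) <-> E0 g (flip g).
  split=> [/asboolP[g' /(c0P.2 _ _) E H]|H]; last by apply/asboolP; exists g.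
  by apply: (Etrans _ _ _ (Esym _ _ E)); apply: (Etrans _ _ _ H); apply: flipE.
have cardp := fixed_classes c0P pP.
have [||||n [f [en fP]]] := @involution_orbits M F c0 E0 (twisted_conj phi) flip p c0P.
- exact: flipE.
- move=> g; exists (mA * mA) => //; rewrite /flip gmulfM !mulgA mulgVK.
  by rewrite mulgVK.
- move=> g g'; rewrite twisted_conjP; split=> [[h E]|].
    case eh : h.2; [right|left; by exists h].
    exists (h * mA^-1); first by case: h eh {E} => [[[x y] z] []].
    by rewrite gmulfM mult_inv mulgA E /flip -!mulgA mulKg.
  move=> [[h _ E]|[h _ E]]; first by exists h.
  by exists (h * mA); rewrite gmulfM mulgA E /flip !mulgA mulgVK.
- exact: pP.
have -> : (2 * (`|(a + d)%R| + #|fixed_mod2 a b c d s t|) = n)%N by lia.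
by apply/reidemeister_number_Some; exists f.
Qed.

End FiniteCount.

(** * The spectrum by parities *)

Section Spectrum.
Variables k1 k2 k3 k4 : int.
Local Notation M := (ac_model k1 k2 k3 k4).
Local Notation q := (qform k1 k2 k3 k4).

(** The data induced by the automorphisms with finite Reidemeister number. *)
Definition admissible (a b c d s t : int) : Prop :=
  [/\ (a * d - b * c = -1)%R, (a + d != 0)%R &
    forall y z : int, par (q (a * y + c * z + s) (b * y + d * z + t))%R = par (q y z)].

Definition realizable (n : nat) : Prop :=
  exists a b c d s t : int, admissible a b c d s t /\
    n = (2 * (`|(a + d)%R| + #|fixed_mod2 k1 k2 k3 k4 a b c d s t|))%N.

Lemma spec_R_realizable : (0 < k1)%R ->
  spec_R (ac_group k1 k2 k3 k4) = with_infty [set n | realizable n].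
Proof.
move=> k1_gt0; have [F Fbij] := ac_group_iso k1 k2 k3 k4; rewrite (spec_R_iso Fbij).
apply/seteqP; split=> [_ [phi phi_bij <-]|_
    [[_ [a [b [c [d [s [t [[det tr qP] ->]]]]]]] <-]|->]].
- have [nu [a [b [c [d [s [t [phiP nu1]]]]]]]] := aut_induces phi_bij.
  have det := induces_det phiP k1_gt0.
  case: nu1 => nuE; first by right; rewrite (reidemeister_central phiP).
  have [tr0|tr] := eqVneq (a + d)%R 0%R.
    right; apply: (reidemeister_singular phiP).
    by transitivity (1 - (a + d) + (a * d - b * c))%R; [ring|rewrite -det tr0 nuE].
  rewrite nuE in phiP det; left; rewrite (reidemeister_finite phiP) //.
  eexists; last by []; exists a, b, c, d, s, t; split=> //; split=> // y z.
  have [x e] := induces_qform phiP y z.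
  by apply/par_eq; exists (- x - q y z)%R; lia.
- have [phi phi_bij phiP] := aut_exists det qP.
  by exists phi => //; rewrite (reidemeister_finite phiP).
- have [phi phiE] : exists phi : {multiplicative M -> M}, phi = id :> (M -> M).
    exact: mult_of.
  exists phi; first by rewrite /= phiE; exists id.
  apply: (@reidemeister_central _ _ _ _ _ 1 1 0 0 1 0 0)%R => //; rewrite /induces phiE.
  split=> [x|x y z e]; first by rewrite mul1r.
  by exists x; case: e; congr (_, _, _, _); ring.
Qed.

End Spectrum.

Definition bit_qform (K1 K2 K3 K4 y z : bool) : bool :=
  K2 && y (+) K3 && z (+) K1 && z && y (+) K4.

Definition bit_fixed K1 K2 K3 K4 (A B C D S T y z : bool) : bool :=
  [&& (A && y (+) C && z (+) S) == y, (B && y (+) D && z (+) T) == z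
    & ~~ bit_qform K1 K2 K3 K4 y z].

Definition bit_fixed_count K1 K2 K3 K4 (A B C D S T : bool) : nat :=
  let f := bit_fixed K1 K2 K3 K4 A B C D S T in
  (f true true + f true false + f false true + f false false)%N.

Definition bit_admissible K1 K2 K3 K4 (A B C D S T : bool) : Prop :=
  forall y z, bit_qform K1 K2 K3 K4 (A && y (+) C && z (+) S) (B && y (+) D && z (+) T)
    = bit_qform K1 K2 K3 K4 y z.

Lemma par_qform k1 k2 k3 k4 y z :
  par (qform k1 k2 k3 k4 y z) =
    bit_qform (par k1) (par k2) (par k3) (par k4) (par y) (par z).
Proof. by rewrite /qform /bit_qform !parE. Qed.

Lemma par_bool (b : bool) : par b%:R%R = b. Proof. by case: b. Qed.

Lemma card_fixed_mod2 k1 k2 k3 k4 a b c d s t :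
  #|fixed_mod2 k1 k2 k3 k4 a b c d s t| =
    bit_fixed_count (par k1) (par k2) (par k3) (par k4)
      (par a) (par b) (par c) (par d) (par s) (par t).
Proof.
have E u : fixed_mod2 k1 k2 k3 k4 a b c d s t u =
    bit_fixed (par k1) (par k2) (par k3) (par k4)
      (par a) (par b) (par c) (par d) (par s) (par t) u.1 u.2.
  by rewrite /fixed_mod2 /bit_fixed par_qform !parE !par_bool.
rewrite -sum1_card big_mkcond /=.
rewrite (eq_bigr (fun u : bool * bool => bit_fixed (par k1) (par k2) (par k3) (par k4)
    (par a) (par b) (par c) (par d) (par s) (par t) u.1 u.2 : nat)); last first.
  move=> u _; rewrite -E -[u \in _]/(fixed_mod2 k1 k2 k3 k4 a b c d s t u).
  by case: fixed_mod2.
rewrite -(pair_bigA _ (fun y z => bit_fixed (par k1) (par k2) (par k3) (par k4)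
    (par a) (par b) (par c) (par d) (par s) (par t) y z : nat)) /=.
by rewrite !big_bool /= addnA.
Qed.

Lemma admissible_bits k1 k2 k3 k4 a b c d s t :
  (a * d - b * c = -1)%R -> (a + d != 0)%R ->
  admissible k1 k2 k3 k4 a b c d s t <->
  bit_admissible (par k1) (par k2) (par k3) (par k4)
    (par a) (par b) (par c) (par d) (par s) (par t).
Proof.
move=> det tr; split=> [[_ _ H] y z|H].
  by have := H y%:R%R z%:R%R; rewrite !par_qform !parE !par_bool.
by split=> // y z; rewrite !par_qform !parE.
Qed.

Definition spectrum_of_parities (K1 K2 K3 K4 : bool) : set nat :=
  if K1 then
    if K2 && K3 (+) K4 then [set (2 * n + 2)%N | n in pos_nat]
    else [set (4 * n - 2)%N | n in pos_nat]
  else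
    if [&& ~~ K2, ~~ K3 & K4] then [set (2 * n)%N | n in pos_nat]
    else [set (4 * n)%N | n in pos_nat].

(** By enumeration of the affine maps of (Z/2)^2 that preserve q.  When k1 is odd
    and q has a single zero, this zero is fixed; when q has three zeros, their
    permutation fixes one or three of them if the trace is even and none if it
    is odd.  When k1 is even, the trace is even unless q is constant, and the
    number of fixed zeros has the parity of the trace unless q = 1. *)
Lemma fixed_count_parity K1 K2 K3 K4 A B C D S T :
  A && D (+) B && C -> bit_admissible K1 K2 K3 K4 A B C D S T ->
  let f := bit_fixed_count K1 K2 K3 K4 A B C D S T in
  if K1 then if K2 && K3 (+) K4 then f = 1%N else odd f = ~~ (A (+) D)
  else [&& ~~ K2, ~~ K3 & K4] \/ odd f = (A (+) D).
Proof.
move=> det H.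
move: (H true true) (H true false) (H false true) (H false false) det => {H}.
case: K1; case: K2; case: K3; case: K4;
  case: A; case: B; case: C; case: D; case: S; case: T;
  rewrite /=; by [|move=> * //; right|left].
Qed.

Lemma spectrum_sub k1 k2 k3 k4 a b c d s t : admissible k1 k2 k3 k4 a b c d s t ->
  spectrum_of_parities (par k1) (par k2) (par k3) (par k4)
    (2 * (`|(a + d)%R| + #|fixed_mod2 k1 k2 k3 k4 a b c d s t|))%N.
Proof.
move=> adm; have [det tr _] := adm.
have parT : par (a + d)%R = odd `|(a + d)%R|%N.
  have [k e] := parP (a + d)%R; case: (par (a + d)%R) e => /= e; lia.
have detb : par a && par d (+) par b && par c.
  by rewrite -!parM -[par (b * c)%R]parN -parD det.
have := fixed_count_parity detb ((admissible_bits _ _ _ _ _ _ det tr).1 adm).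
rewrite /= -card_fixed_mod2 -parD parT; set f := #|_|; set T := `|(a + d)%R|%N.
have T0 : (0 < T)%N by rewrite absz_gt0.
rewrite /spectrum_of_parities; case: (par k1).
  case: ifP => _ e; first by exists T => //; rewrite e; lia.
  exists ((T + f).+1./2)%N; rewrite /pos_nat /=; move: e;
    case: (odd T) (odd_double_half T); lia.
case: ifP => [_ _|_ []//]; first by exists (T + f)%N => //; rewrite /pos_nat /=; lia.
move=> e; exists ((T + f)./2)%N; rewrite /pos_nat /=; lia.
Qed.

Lemma realizable_bits k1 k2 k3 k4 (a b c d s t : int) (T f : nat) :
  (a * d - b * c = -1)%R -> (0 < T)%N -> (a + d = T%:Z)%R ->
  bit_admissible (par k1) (par k2) (par k3) (par k4)
    (par a) (par b) (par c) (par d) (par s) (par t) ->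
  bit_fixed_count (par k1) (par k2) (par k3) (par k4)
    (par a) (par b) (par c) (par d) (par s) (par t) = f ->
  realizable k1 k2 k3 k4 (2 * (T + f))%N.
Proof.
move=> det T0 trT adm fE; exists a, b, c, d, s, t.
have tr0 : (a + d != 0)%R by rewrite trT; lia.
split; first exact/(admissible_bits _ _ _ _ _ _ det tr0).
by rewrite card_fixed_mod2 -fE trT.
Qed.

(** For odd k1 let P = (k3 + 1, k2 + 1), the exceptional point of q modulo 2: the
    only zero of q or the only non-zero of q.  A companion matrix of prescribed
    trace, with w = P - L P modulo 2, fixes P; in the second case the trace 2 m - 1 is
    odd, so that no other point is fixed and f = 0.  For even k1, if q = 1 then
    f = 0 for every companion matrix.  In the remaining cases the trace is 2 m,
    L modulo 2 is a transvection that preserves the linear part of q, and w, in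
    the kernel of that part, is chosen so that u -> L u + w has no fixed point
    on the zeros of q. *)
Lemma spectrum_sup k1 k2 k3 k4 n :
  spectrum_of_parities (par k1) (par k2) (par k3) (par k4) n ->
  realizable k1 k2 k3 k4 n.
Proof.
rewrite /spectrum_of_parities; have [K1|K1] := boolP (par k1).
  pose p : int := ((~~ par k3)%:R + (~~ par k2)%:R)%R.
  pose w (m : int) : int := (p + m * (~~ par k2)%:R)%R.
  case: ifP => K4 [m m0 <-].
    have -> : (2 * m + 2 = 2 * (m + 1))%N by lia.
    apply: (@realizable_bits _ _ _ _ 0 1 1 m%:Z p (w m%:Z))%R => //;
      rewrite ?mul0r ?add0r //.
      move=> y z; rewrite K1 /w /p !parE !par_bool; move: K4.
      by case: (par k2) (par k3) (par k4) (par m) y z => [] [] [] [] [] [].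
    rewrite K1 /w /p !parE !par_bool; move: K4.
    by case: (par k2) (par k3) (par k4) (par m) => [] [] [] [].
  rewrite /pos_nat /= in m0.
  have -> : (4 * m - 2 = 2 * ((2 * m).-1 + 0))%N by lia.
  have podd : par (2 * m).-1 = true.
    by apply: (@par_unique _ (m%:Z - 1)%R); lia.
  apply: (@realizable_bits _ _ _ _ 0 1 1 (2 * m).-1%:Z p (w 1))%R => //;
    rewrite ?mul0r ?add0r //.
  - by lia.
  - move=> y z; rewrite K1 podd /w /p !parE !par_bool; move: K4.
    by case: (par k2) (par k3) (par k4) y z => [] [] [] [] [].
  - rewrite K1 podd /w /p !parE !par_bool; move: K4.
    by case: (par k2) (par k3) (par k4) => [] [] [].
have {}K1 : par k1 = false by apply/negbTE.
case: ifP => [/and3P[/negbTE K2 /negbTE K3 K4]|K234] [m m0 <-].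
  have -> : (2 * m = 2 * (m + 0))%N by lia.
  apply: (@realizable_bits _ _ _ _ 0 1 1 m%:Z 0 0)%R => //;
    rewrite ?mul0r ?add0r //.
    by move=> y z; rewrite K1 K2 K3 K4.
  by rewrite K1 K2 K3 K4; case: (par m%:Z).
rewrite /pos_nat /= in m0; have -> : (4 * m = 2 * (2 * m + 0))%N by lia.
have m2 : (0 < 2 * m)%N by lia.
have peven : par (2 * m)%N = false by apply: (@par_unique _ m%:Z); lia.
have podd : par ((2 * m)%N%:Z - 1)%R = true by rewrite parD peven.
have [K23|K23] := boolP (par k2 == par k3).
  pose s : int := ((par k2)%:R * (~~ par k4)%:R)%R.
  pose s0 : int := ((~~ par k2)%:R + s)%R.
  apply: (@realizable_bits _ _ _ _ 0 1 1 (2 * m)%N s0 s)%R => //;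
    rewrite ?mul0r ?add0r //.
    move=> y z; rewrite K1 peven /s0 /s !parE !par_bool; move: K23 K234.
    by case: (par k2) (par k3) (par k4) y z => [] [] [] [] [].
  rewrite K1 peven /s0 /s !parE !par_bool; move: K23 K234.
  by case: (par k2) (par k3) (par k4) => [] [] [].
have [K2|K2] := boolP (par k2).
  have K3 : par k3 = false by move: K23; rewrite K2; case: (par k3).
  apply: (@realizable_bits _ _ _ _ 1 1 (2 * m)%N ((2 * m)%N%:Z - 1)
    0 (~~ par k4)%:R)%R => //; [lia|lia| |].
    move=> y z; rewrite K1 K2 K3 peven podd !par_bool.
    by case: (par k4) y z => [] [] [].
  by rewrite K1 K2 K3 peven podd !par_bool; case: (par k4).
have K3 : par k3 by move: K23 K2; case: (par k3); case: (par k2).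
have {}K2 := negbTE K2.
apply: (@realizable_bits _ _ _ _ ((2 * m)%N%:Z - 1) (2 * m)%N 1 1
  (~~ par k4)%:R 0)%R => //; [lia|lia| |].
  move=> y z; rewrite K1 K2 K3 peven podd !par_bool.
  by case: (par k4) y z => [] [] [].
by rewrite K1 K2 K3 peven podd !par_bool; case: (par k4).
Qed.

Lemma spec_R_parities k1 k2 k3 k4 : (0 < k1)%R -> spec_R (ac_group k1 k2 k3 k4) =
  with_infty (spectrum_of_parities (par k1) (par k2) (par k3) (par k4)).
Proof.
move=> /spec_R_realizable ->; congr with_infty; apply/seteqP.
split=> n /=; last exact: spectrum_sup.
by move=> [a [b [c [d [s [t [adm ->]]]]]]]; exact: spectrum_sub.
Qed.

Lemma paritiesE k1 k2 k3 k4 :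
  parities k1 k2 k3 k4 = ((par k1)%:R, (par k2)%:R, (par k3)%:R, (par k4)%:R)%R.
Proof.
have E (k : int) : (k %% 2)%Z = (par k)%:R%R.
  rewrite /par; have := modz_ge0 k (isT : (2 != 0 :> int)%R).
  have := ltz_mod k (isT : (2 != 0 :> int)%R); case: eqP => /=; lia.
by rewrite /parities !E.
Qed.

Theorem mainTheorem2 (k1 k2 k3 k4 : int) (hk1 : (0 < k1)%R) :
  (forall l1 l2 l3 l4 : int, (0 < l1)%R ->
     parities l1 l2 l3 l4 = parities k1 k2 k3 k4 ->
     spec_R (ac_group l1 l2 l3 l4) = spec_R (ac_group k1 k2 k3 k4)) /\
  (parities k1 k2 k3 k4 = (0, 0, 0, 1)%R ->
     spec_R (ac_group k1 k2 k3 k4) =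
       with_infty [set (2 * n)%N | n in pos_nat]) /\
  (parities k1 k2 k3 k4 \in
     [:: (0, 0, 0, 0); (0, 0, 1, 0); (0, 0, 1, 1); (0, 1, 0, 0);
         (0, 1, 0, 1); (0, 1, 1, 0); (0, 1, 1, 1)]%R ->
     spec_R (ac_group k1 k2 k3 k4) =
       with_infty [set (4 * n)%N | n in pos_nat]) /\
  (parities k1 k2 k3 k4 \in
     [:: (1, 0, 0, 0); (1, 0, 1, 0); (1, 1, 0, 0); (1, 1, 1, 1)]%R ->
     spec_R (ac_group k1 k2 k3 k4) =
       with_infty [set (4 * n - 2)%N | n in pos_nat]) /\
  (parities k1 k2 k3 k4 \in
     [:: (1, 0, 0, 1); (1, 0, 1, 1); (1, 1, 0, 1); (1, 1, 1, 0)]%R ->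
     spec_R (ac_group k1 k2 k3 k4) =
       with_infty [set (2 * n + 2)%N | n in pos_nat]).
Proof.
split=> [l1 l2 l3 l4 hl1|].
  by rewrite !paritiesE !spec_R_parities //; do 8!case: (par _).
rewrite paritiesE spec_R_parities //.
by case: (par k1); case: (par k2); case: (par k3); case: (par k4).
Qed.
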